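(* Let $(X,d_X)$ and $(Y,d_Y)$ be complete, doubling, quasiconvex metric spaces. Let $\Omega\subsetneq X$ be a bounded domain satisfying the bounded turning condition and let $D\subsetneq Y$ be a bounded domain finitely connected at the boundary. Then a homeomorphism $f\in\mathcal F(\Omega,D)$ extends to a homeomorphism $F_{\mathrm P}:\overline\Omega\to D\cup\partial_{\mathrm P}D$ continuous with respect to the distance $\mathrm{dist}^*_M$ on $D\cup\partial_{\mathrm P}D$. Namely, $F_{\mathrm P}$ is given by $$F_{\mathrm P}(x)=\begin{cases} f(x), & x\in\Omega,\\ [f(G_k^x)], & x\in\partial\Omega,\end{cases}$$ where $[G_k^x]$ is the unique prime end in $\partial_{\mathrm{SP}}\Omega$ with $I[G_k^x]=\{x\}$.
   Context: Conventions. A domain is a nonempty open connected set. A curve is a continuous map from a compact interval (or its image). A metric space is quasiconvex if there is $C\ge 1$ such that any two points $x,y$ are joined by a curve of length at most $C\,d(x,y)$. Distances in a domain $\Omega\subset X$. The inner diameter distance is $d_{\rm inn}(x,y)=\inf \operatorname{diam}\gamma$, the infimum over all locally rectifiable curves $\gamma\subset\Omega$ joining $x,y\in\Omega$. The Mazurkiewicz distance is $d_M(x,y)=\inf\operatorname{diam}K$, the infimum over all connected sets $K\subset\Omega$ containing $x,y$. For points $x,y\in\overline\Omega$ it is understood as the infimum of $\operatorname{diam}K$ over connected sets $K\subset\Omega\cup\{x,y\}$ containing $x,y$. $\mathrm{dist}_{\rm inn}(A,B)$ and $\mathrm{dist}_M(A,B)$ denote the infima of $d_{\rm inn}(a,b)$,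 respectively $d_M(a,b)$, over $a\in A$, $b\in B$; for singletons these are the distances of the points. Class $\mathcal F$. A homeomorphism $f$ from $\Omega$ onto $D$ belongs to $\mathcal F(\Omega,D)$ if for any two connected sets $E,F\subsetneq\Omega$: $\mathrm{dist}_{\rm inn}(E,F)=0$ if and only if $\mathrm{dist}_{\rm inn}(f(E),f(F))=0$ (the latter distance taken in $D$). Bounded turning. $\Omega$ satisfies the bounded turning condition (is linearly connected) if there is $L\ge1$ such that all $x,y\in\Omega$ lie in a continuum $K\subset\Omega$ with $\operatorname{diam}K\le L\,d_X(x,y)$. Finite connectedness. $D\subset Y$ is finitely connected at the boundary if for every $y\in\partial D$ and $r>0$ there is a bounded open set $U$ with $y\in U\subset B(y,r)$ such that $U\cap D$ has only finitely many components. Prime ends of a bounded domain $\Omega\subsetneq X$ (similarly for $D\subsetneq Y$). A bounded connected set $E\subsetneq\Omega$ is acceptable if $\overline E\cap\partial\Omega\ne\emptyset$. A chain is a sequence $\{E_k\}_{k\ge1}$ of acceptable sets such that for all $k$: (1) $E_{k+1}\subset E_k$; (2) $\mathrm{dist}_M(\Omega\cap\partial E_{k+1},\Omega\cap\partial E_k)>0$; and (3) the impression $\bigcap_k\overline{E_k}$ is contained in $\partial\Omega$. A chain $\{E_k\}$ divides a chain $\{F_k\}$ if for each $k$ there is $l_k$ with $E_{l}\subset F_k$ for all $l\ge l_k$. Two chains are equivalent if they divide each other. An end $[E_k]$ is an equivalence class of chains; its impression $I[E_k]$ is the impression of any representative; division passes to ends. A prime end is an end not divisible by any other end. $\partial_{\mathrm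 P}\Omega$ is the set of all prime ends, and $\partial_{\mathrm{SP}}\Omega$ the set of prime ends whose impression is a single point. Known facts used in the statement. If $\Omega$ satisfies the bounded turning condition, then for every $x\in\partial\Omega$ there is a unique prime end of $\Omega$ with $x$ in its impression; it has impression $\{x\}$ and is the one defined by the sets $G_k^x=B(x,1/k)\cap\Omega$, $k=1,2,\dots$. If $D$ is finitely connected at the boundary, all its prime ends have singleton impressions. The distance $\mathrm{dist}^*_M$. For $D$ finitely connected at the boundary and $[E_k],[F_n]\in\partial_{\mathrm P}D$, $x,y\in D$: $\mathrm{dist}^*_M([E_k],[F_n])=\mathrm{dist}_M(I[E_k],I[F_n])$, $\mathrm{dist}^*_M(x,[E_k])=\mathrm{dist}_M(x,I[E_k])$, $\mathrm{dist}^*_M(x,y)=\mathrm{dist}_M(x,y)$. $\overline\Omega$ carries the metric $d_X$.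
   Formalization: Since dist*_M can vanish between distinct prime ends (slit disc), F_P is shown to be a homeomorphism for the prime end topology and dist*_M-continuous; its inverse is dist*_M-continuous only at points at positive dist*_M from every other point. *)

(* Defs.v *)
From mathcomp Require Import all_boot all_order all_algebra.
From mathcomp Require Import all_classical all_reals all_analysis.

Set Implicit Arguments.
Unset Strict Implicit.
Unset Printing Implicit Defensive.
Import Order.TTheory GRing.Theory Num.Theory.
Import numFieldNormedType.Exports.
Local Open Scope classical_set_scope.
Local Open Scope ring_scope.

Section Metric_spaces.
Context {R : realType}.
Variable X : metricType R.
Implicit Types (A B K : set X) (x y : X).

(* The diameter of the empty set is -oo here; only diameters of nonempty sets
   are used. *)
Definition diam A : \bar R :=
  ereal_sup [set (mdist p.1 p.2)%:E | p in A `*` A].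

Definition metric_bounded A :=
  exists M : R, forall x y, A x -> A y -> mdist x y <= M.

Definition frontier A : set X := closure A `\` interior A.

Definition complete_space :=
  forall F : set_system X, ProperFilter F -> cauchy F -> exists x, F --> x.

Definition doubling :=
  exists N : nat, forall x (r : R), 0 < r ->
    exists2 s : seq X, (size s <= N)%N &
      ball x r `<=` \bigcup_(y in [set` s]) ball y (r / 2).

Definition is_curve (a b : R) (g : R -> X) :=
  a <= b /\ {within `[a, b], continuous g}.

Definition curve_length (a b : R) (g : R -> X) : \bar R :=
  ereal_sup [set (\sum_(0 <= i < size s)
      mdist (g (nth b (a :: s) i)) (g (nth b (a :: s) i.+1)))%:E
    | s in itv_partition a b].

Definition locally_rectifiable (a b : R) (g : R -> X) :=
  forall t, a <= t <= b -> exists2 e : R, 0 < e &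
    forall c d, a <= c -> c <= d -> d <= b -> `|c - t| < e -> `|d - t| < e ->
      (curve_length c d g < +oo)%E.

Definition quasiconvex := exists2 C : R, 1 <= C &
  forall x y, exists a b (g : R -> X),
    [/\ is_curve a b g, g a = x, g b = y &
        (curve_length a b g <= (C * mdist x y)%:E)%E].

Definition domain A := [/\ A !=set0, open A & connected A].

Definition d_inn (Omega : set X) x y : \bar R :=
  ereal_inf [set d | exists a b (g : R -> X),
    [/\ is_curve a b g /\ locally_rectifiable a b g,
        g a = x, g b = y, g @` `[a, b] `<=` Omega & d = diam (g @` `[a, b])]].

(* For x and y in Omega the last condition is just K `<=` Omega. *)
Definition d_M (Omega : set X) x y : \bar R :=
  ereal_inf [set diam K | K in
    [set K | [/\ connected K, K x, K y & K `<=` Omega `|` [set x; y]]]].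

Definition dist_inn (Omega A B : set X) : \bar R :=
  ereal_inf [set d_inn Omega p.1 p.2 | p in A `*` B].

Definition dist_M (Omega A B : set X) : \bar R :=
  ereal_inf [set d_M Omega p.1 p.2 | p in A `*` B].

Definition bounded_turning (Omega : set X) := exists2 L : R, 1 <= L &
  forall x y, Omega x -> Omega y -> exists K : set X,
    [/\ compact K /\ connected K, K `<=` Omega, K x, K y &
        (diam K <= (L * mdist x y)%:E)%E].

Definition finitely_connected_at_boundary (D : set X) :=
  forall y (r : R), frontier D y -> 0 < r ->
    exists U : set X,
      [/\ open U /\ metric_bounded U, U y, U `<=` ball y r &
          finite_set (connected_component (U `&` D) @` (U `&` D))].

End Metric_spaces.

Section Class_F.
Context {R : realType}.
Variables X Y : metricType R.

(* f and its inverse are total functions, constrained on Omega and D only. *)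
Definition homeomorphism_onto (Omega : set X) (D : set Y) (f : X -> Y) :=
  [/\ set_bij Omega D f, {within Omega, continuous f} &
      exists2 g : Y -> X, {within D, continuous g} &
        forall x, Omega x -> g (f x) = x].

Definition class_F (Omega : set X) (D : set Y) (f : X -> Y) :=
  homeomorphism_onto Omega D f /\
  forall E F : set X, connected E -> connected F ->
    E `<` Omega -> F `<` Omega ->
    (dist_inn Omega E F = 0%E <-> dist_inn D (f @` E) (f @` F) = 0%E).

End Class_F.

Section Prime_ends.
Context {R : realType}.
Variable X : metricType R.
Variable Omega : set X.
Implicit Types (E F S : nat -> set X) (p q : set (nat -> set X)).

Definition acceptable (A : set X) :=
  [/\ metric_bounded A, connected A, A `<` Omega &
      closure A `&` frontier Omega !=set0].

Definition impression E : set X := \bigcap_k closure (E k).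

(* Sequences are indexed from 0 instead of 1. *)
Definition chain E :=
  [/\ forall k, acceptable (E k),
      forall k, E k.+1 `<=` E k,
      forall k, (0 < dist_M Omega (Omega `&` frontier (E k.+1))
                                  (Omega `&` frontier (E k)))%E &
      impression E `<=` frontier Omega].

Definition divides E F :=
  forall k, exists l0, forall l, (l0 <= l)%N -> E l `<=` F k.

Definition equivalent E F := divides E F /\ divides F E.

(* If S is a chain, end_of S is its equivalence class.  Equivalence also makes
   sense for a sequence of sets S that is not itself a chain; end_of S is then
   the class of the chains equivalent to S (the empty set if there are none).
   This matters for the sets B(x, 1/k) `&` Omega, which need not be connected
   even if Omega is of bounded turning. *)
Definition end_of S : set (nat -> set X) :=
  [set F | chain F /\ equivalent S F].

Definition is_end p := exists2 E, chain E & p = end_of E.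

Definition end_impression p : set X := \bigcup_(E in p) impression E.

Definition end_divides p q :=
  exists E F, [/\ p E, q F & divides E F].

Definition prime_ends : set (set (nat -> set X)) :=
  [set p | is_end p /\ forall q, is_end q -> end_divides q p -> q = p].

Definition singleton_prime_ends : set (set (nat -> set X)) :=
  [set p | prime_ends p /\ exists x, end_impression p = [set x]].

(* Omega together with its prime ends, inside the disjoint sum of all points
   and all classes of sequences of sets. *)
Definition prime_closure : set (X + set (nat -> set X)) :=
  [set u | match u with inl x => Omega x | inr p => prime_ends p end].

Definition impression_of (u : X + set (nat -> set X)) : set X :=
  match u with inl x => [set x] | inr p => end_impression p end.

(* This function vanishes on two distinct prime ends that have the same
   one-point impression, so it does not separate points in general. *)
Definition dist_M_star (u v : X + set (nat -> set X)) : \bar R :=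
  dist_M Omega (impression_of u) (impression_of v).

(* The usual topology of the prime end closure: points x_n of Omega converge to
   the prime end [E_k] when each E_k contains x_n for all large n, prime ends
   [F^n] converge to [E_k] when, for each k and all large n, some F^n_l lies in
   E_k, and a set is closed when it contains the limits of its sequences.
   The sets E_k, enlarged by the prime ends one of whose chains enters E_k, are
   therefore basic neighbourhoods of [E_k]. *)
Definition prime_end_open (U : set (X + set (nat -> set X))) :=
  [/\ U `<=` prime_closure,
      forall x, U (inl x) -> nbhs x [set z | U (inl z)] &
      forall p, U (inr p) -> forall E, p E -> exists k,
        (forall z, E k z -> U (inl z)) /\
        (forall q, prime_ends q ->
           (exists2 F, q F & exists l, F l `<=` E k) -> U (inr q))].

End Prime_ends.

Definition G_ {R : realType} {X : metricType R} (Omega : set X) (x : X)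
    (k : nat) : set X :=
  ball x (k.+1%:R^-1) `&` Omega.

(* Main.v *)
Require Import Defs.
From mathcomp Require Import all_boot all_order all_algebra.
From mathcomp Require Import all_classical all_reals all_analysis.
From mathcomp Require Import lra.
Set Implicit Arguments.
Unset Strict Implicit.
Unset Printing Implicit Defensive.
Import Order.TTheory GRing.Theory Num.Theory.
Import numFieldNormedType.Exports.
Local Open Scope classical_set_scope.
Local Open Scope ring_scope.

(* Since X and Y are quasiconvex, a connected subset of an open set can be
   thickened to contain rectifiable curves without much increase of its
   diameter, so d_inn and d_M agree on open sets and class F only involves d_M.
   Both Omega (by bounded turning) and D (by finite connectedness at the
   boundary) are finite unions of connected sets of arbitrarily small diameter.
   Hence if f were not uniformly continuous from d_M to d_M, two small connected
   pieces V, W of D would have preimages at distance 0 while V and W are not,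
   against class F; the same argument applies to the inverse of f.  So f and its
   inverse send chains to chains and preserve divisibility.  In Omega, a chain
   with x in its impression is divided by the sets B(x, 1/k), because a short
   continuum joining E_{k+1} to the complement of E_k would cross both frontiers;
   so the prime ends of Omega are the [G^x], and those of D are their images.
   Finally the images of small balls have small d_M-diameter, which makes the
   impressions in D singletons and gives the statements on dist*_M. *)

(** * Ultrafilters and metric topology *)

Section Ultrafilters.

(** Otherwise the ultrafilter contains every complement, hence their finite intersection, which
    misses the union. It selects one piece from a finite cover. *)
Lemma ultra_bigcup_finite T (I : choiceType) (F : set_system T) (J : set I)
    (B : I -> set T) : UltraFilter F -> finite_set J ->
  F (\bigcup_(i in J) B i) -> exists2 i, J i & F (B i).
Proof.
move=> FU /finite_fsetP[X JX] FJ; apply: contrapT => noB.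
have FC i : J i -> F (~` B i).
  move=> Ji; have [FB|//] := in_ultra_setVsetC (B i) FU.
  by exfalso; apply: noB; exists i.
have FX : F (\bigcap_(i in J) ~` B i).
  by rewrite JX; apply: filter_bigI => i iX; apply: FC; rewrite JX.
have [z [[i Ji Biz] zC]] := filter_ex (filterI FJ FX).
exact: zC Biz.
Qed.

Lemma ultra_fmap T U (h : T -> U) (F : set_system T) :
  UltraFilter F -> UltraFilter (h @ F).
Proof.
move=> FU; split; first exact: fmap_proper_filter.
move=> G GF FG; rewrite predeqE => A; split; last exact: FG.
move=> GA; have [//|FA] := in_ultra_setVsetC (h @^-1` A) FU.
have GC : G (~` A) by exact: FG.
by have [z [Az]] := filter_ex (filterI GA GC).
Qed.

End Ultrafilters.

Section Metric_topology.
Context {R : realType}.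
Implicit Types X Y : metricType R.

Lemma nbhs_mdistP X (x : X) (A : set X) :
  nbhs x A <-> exists2 r : R, 0 < r & forall z, mdist x z < r -> A z.
Proof.
rewrite nbhs_ballP; split=> -[r r0 rA]; exists r => // z xz; apply: rA.
  by rewrite ballEmdist.
by rewrite ballEmdist in xz.
Qed.

Lemma open_mdistP X (A : set X) : open A <->
  forall x, A x -> exists2 r : R, 0 < r & forall z, mdist x z < r -> A z.
Proof.
rewrite openE; split=> oA x Ax; first exact/nbhs_mdistP/oA.
exact/nbhs_mdistP/oA.
Qed.

Lemma closure_mdistP X (A : set X) (x : X) :
  closure A x <-> forall r : R, 0 < r -> exists2 a, A a & mdist x a < r.
Proof.
split=> [cA r r0|cA B /nbhs_mdistP[r r0 rB]].
  have /cA[a [Aa xa]] : nbhs x [set z | mdist x z < r].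
    by apply/nbhs_mdistP; exists r.
  by exists a.
by have [a Aa xa] := cA r r0; exists a; split=> //; exact: rB.
Qed.

Lemma open_mdist_ball X (x : X) (r : R) : open [set z | mdist x z < r].
Proof.
apply/open_mdistP => z /= xz; exists (r - mdist x z); first by rewrite subr_gt0.
by move=> w zw; rewrite (le_lt_trans (metric_triangle x z w))// -ltrBrDl.
Qed.

Lemma frontier_open X (A : set X) : open A -> frontier A = closure A `\` A.
Proof. by move=> /interior_id iA; rewrite /frontier iA. Qed.

Lemma closure_mdist_le X (A : set X) (x : X) (r : R) :
  (forall a, A a -> mdist x a <= r) -> forall z, closure A z -> mdist x z <= r.
Proof.
move=> Ar z /closure_mdistP cz; apply/ler_addgt0Pl => e e0.
have [a Aa za] := cz e e0.
rewrite (le_trans (metric_triangle x a z))// addrC lerD ?Ar//.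
by rewrite metric_sym ltW.
Qed.

Lemma closure_diam_le X (A : set X) (r : R) :
  (forall u v, A u -> A v -> mdist u v <= r) ->
  forall u v, closure A u -> closure A v -> mdist u v <= r.
Proof.
move=> Ar u v cu cv; apply: (closure_mdist_le _ cv) => a Aa.
by rewrite metric_sym; apply: (closure_mdist_le _ cu) => b Ab; exact: Ar.
Qed.

(** A predicate that is locally constant on [A] splits it into two relatively open parts, and
    membership in a relatively clopen part is locally constant. Later arguments propagate predicates
    along connected sets in this form. *)
Lemma connected_mdistP X (A : set X) : connected A <->
  forall P : set X,
    (forall x, A x -> exists2 r : R, 0 < r &
       forall z, A z -> mdist x z < r -> (P x <-> P z)) ->
    forall x y, A x -> A y -> P x -> P y.
Proof.
split=> [cA P loc x y Ax Ay Px|cP B [x Bx] [C oC BC] [C' cC' BC']].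
  have opn (Q : set X) : (forall x, A x -> exists2 r : R, 0 < r &
       forall z, A z -> mdist x z < r -> (Q x <-> Q z)) ->
       exists2 C, open C & A `&` Q = A `&` C.
    move=> Qloc.
    pose S := [set w | exists u, [/\ A u, Q u & exists2 r : R,
      (forall z, A z -> mdist u z < r -> Q z) & mdist u w < r]].
    exists S.
      apply/open_mdistP => w [u [Au Qu [r ur uw]]].
      have /open_mdistP/(_ w uw)[s s0 sr] := open_mdist_ball u r.
      by exists s => // z wz; exists u; split=> //; exists r => //; exact: sr.
    apply/seteqP; split=> z [Az]; last by move=> [u [Au Qu [r ur uz]]];
      split=> //; exact: ur.
    move=> Qz; split=> //; exists z; split=> //.
    have [r r0 rz] := Qloc z Az; exists r; last by rewrite mdistxx.
    by move=> w Aw zw; exact/(rz w Aw zw).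
  have [C oC AC] := opn P loc.
  have [C' oC' AC'] : exists2 C, open C & A `&` ~` P = A `&` C.
    apply: opn => z Az; have [r r0 rz] := loc z Az; exists r => // w Aw zw.
    by split=> nP Pw; apply: nP; exact/(rz w Aw zw).
  have PA : A `&` P = A.
    apply: cA; [by exists x|by exists C|exists (~` C')].
      exact: open_closedC.
    apply/seteqP; split=> z [Az] /= h; split=> //.
      by move=> C'z; have : (A `&` C') z by []; rewrite -AC' => -[].
    apply: contrapT => nPz; apply: h.
    by have : (A `&` ~` P) z by []; rewrite AC' => -[].
  by move: Ay; rewrite -PA => -[].
have sBA : B `<=` A by rewrite BC => ? [].
apply/seteqP; split=> // y Ay; apply: (cP _ _ x) => //; last exact: sBA.
move=> z Az; have [Bz|nBz] := pselect (B z).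
  have Cz : C z by move: Bz; rewrite BC => -[].
  have /open_mdistP/(_ z Cz)[r r0 rC] := oC; exists r => // w Aw zw.
  by split=> // _; rewrite BC; split=> //; exact: rC.
have Cz : (~` C') z by move=> C'z; apply: nBz; rewrite BC'.
have /open_mdistP/(_ z Cz)[r r0 rC] := closed_openC cC'.
exists r => // w Aw zw; split=> // Bw; exfalso; apply: (rC _ zw).
by move: Bw; rewrite BC' => -[].
Qed.

(** Near each point of [B] lies a point of [A] with the same value of [P], so constancy passes from
    [A] to [B]. *)
Lemma connected_between X (A B : set X) :
  connected A -> A `<=` B -> B `<=` closure A -> connected B.
Proof.
move=> /connected_mdistP cA AB BA; apply/connected_mdistP => P loc x y Bx By Px.
have near z : B z -> exists2 a, A a & (P z <-> P a).
  move=> Bz; have [r r0 rP] := loc z Bz.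
  have [a Aa za] := (closure_mdistP A z).1 (BA _ Bz) r r0.
  by exists a => //; apply: rP => //; exact: AB.
have [a Aa xa] := near x Bx; have [b Ab yb] := near y By.
apply/yb/(cA P _ a) => //; last exact/xa.
move=> z Az; have [r r0 rP] := loc z (AB _ Az).
by exists r => // w Aw; apply: rP; exact: AB.
Qed.

(** Off the frontier, membership in [A] is locally constant, so it could not change along [K]. *)
Lemma connected_meets_frontier X (Om K A : set X) : K `<=` Om ->
  connected K -> (exists2 u, K u & A u) -> (exists2 v, K v & ~ A v) ->
  exists2 z, K z & (Om `&` frontier A) z.
Proof.
move=> KO /connected_mdistP cK [u Ku Au] [v Kv nAv]; apply: contrapT => noz.
apply: nAv; apply: (cK A _ u v) => // z Kz.
have nf : ~ frontier A z by move=> fz; apply: noz; exists z => //; split=> //; exact: KO.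
have [Az|nAz] := pselect (interior A z).
  have [r r0 rA] := (nbhs_mdistP z A).1 Az.
  exists r => // w _ zw; split=> _; first exact: rA.
  exact: interior_subset.
have ncA : ~ closure A z by move=> cz; exact: nf.
have [r r0 rA] : exists2 r : R, 0 < r & forall w, mdist z w < r -> ~ A w.
  apply: contrapT => h; apply: ncA; apply/closure_mdistP => r r0.
  apply: contrapT => h'; apply: h; exists r => // w zw Aw; apply: h'.
  by exists w.
exists r => // w _ zw; split=> Aw; exfalso; last exact: (rA w).
by apply: (rA z) => //; rewrite mdistxx.
Qed.

Lemma continuous_within_mdistP X Y (A : set X) (h : X -> Y) :
  {within A, continuous h} <->
  forall x, A x -> forall e : R, 0 < e -> exists2 d : R, 0 < d &
    forall z, A z -> mdist x z < d -> mdist (h x) (h z) < e.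
Proof.
split=> [/subspace_continuousP ch x Ax e e0|ch].
  have : nbhs (h x) [set y | mdist (h x) y < e].
    by apply/nbhs_mdistP; exists e.
  move=> /(ch x Ax)/nbhs_mdistP[d d0 hd]; exists d => // z Az xz.
  exact: hd.
apply/subspace_continuousP => x Ax B /nbhs_mdistP[e e0 eB].
have [d d0 hd] := ch x Ax e e0; apply/nbhs_mdistP; exists d => // z xz Az.
by apply: eB; exact: hd.
Qed.

Lemma continuous_itv_mdistP X (a b : R) (g : R -> X) :
  {within `[a, b], continuous g} <->
  forall t, a <= t <= b -> forall e : R, 0 < e -> exists2 d : R, 0 < d &
    forall s, a <= s <= b -> `|t - s| < d -> mdist (g t) (g s) < e.
Proof.
split=> [/subspace_continuousP cg t tab e e0|cg].
  have : nbhs (g t) [set y | mdist (g t) y < e].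
    by apply/nbhs_mdistP; exists e.
  have tI : [set` `[a, b]] t by rewrite /= in_itv.
  move=> /(cg t tI)/nbhs_ballP[d d0 gd]; exists d => // s sab ts.
  by apply: gd => //=; rewrite in_itv.
apply/subspace_continuousP => t; rewrite /= in_itv => tab B.
move=> /nbhs_mdistP[e e0 eB].
have [d d0 gd] := cg t tab e e0; apply/nbhs_ballP; exists d => // s ts.
by rewrite /= in_itv => sab; apply: eB; exact: gd.
Qed.

End Metric_topology.

(** * Relative compactness of bounded sets in complete doubling spaces *)

Section Proper_spaces.
Context {R : realType} (X : metricType R).

Definition totally_bounded (A : set X) := forall r : R, 0 < r ->
  exists s : seq X, A `<=` \bigcup_(y in [set` s]) ball y r.

Lemma halving_lt (r e : R) : 0 < r -> 0 < e -> exists n, r / 2 ^+ n < e.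
Proof.
move=> r0 e0; exists (Num.truncn (r / e)).+1.
rewrite ltr_pdivrMr ?exprn_gt0// mulrC -ltr_pdivrMr//.
rewrite (lt_trans (truncnS_gt _))// -natrX ltr_nat; exact: ltn_expl.
Qed.

Lemma doubling_iter (dX : doubling X) n (r : R) (x : X) : 0 < r ->
  exists s : seq X, ball x r `<=` \bigcup_(y in [set` s]) ball y (r / 2 ^+ n).
Proof.
move=> r0; elim: n => [|n [s hs]].
  by exists [:: x] => z xz; exists x; rewrite /= ?inE// divr1.
have rn0 : 0 < r / 2 ^+ n by rewrite divr_gt0// exprn_gt0.
case: dX => N /(_ _ _ rn0) dN.
have [h hP] : exists h : X -> seq X, forall y, ball y (r / 2 ^+ n) `<=`
    \bigcup_(z in [set` h y]) ball z (r / 2 ^+ n / 2).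
  have H y : exists s' : seq X, ball y (r / 2 ^+ n) `<=`
    \bigcup_(z in [set` s']) ball z (r / 2 ^+ n / 2).
    by have [s' _ ?] := dN y; exists s'.
  by have [h] := choice H; exists h.
exists (flatten [seq h y | y <- s]) => z /hs[y /= ys /hP[w /= wh zw]].
exists w; last by rewrite exprSr invfM mulrA.
by rewrite /=; apply/flatten_mapP; exists y.
Qed.

Lemma bounded_totally_bounded (A : set X) :
  doubling X -> metric_bounded A -> totally_bounded A.
Proof.
move=> dX [M AM] r r0; have [->|/set0P[a Aa]] := eqVneq A set0; first by exists [::].
have M0 : 0 < `|M| + 1 by rewrite ltr_pwDr.
have [n Mn] := halving_lt M0 r0.
have [s hs] := doubling_iter dX n a M0; exists s => z Az.
have [|y ys yz] := hs z.
  rewrite ballEmdist /= (le_lt_trans (AM _ _ Aa Az))//.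
  by rewrite (le_lt_trans (ler_norm M))// ltrDl.
by exists y => //; apply: le_ball yz; exact: ltW.
Qed.

Lemma totally_bounded_closure (A : set X) :
  totally_bounded A -> totally_bounded (closure A).
Proof.
move=> tA r r0; have [|s sA] := tA (r / 2); first by rewrite divr_gt0.
exists s => z /closure_mdistP/(_ (r / 2))[|a /sA[y /= ys ya] za].
  by rewrite divr_gt0.
exists y => //; rewrite ballEmdist /= (splitr r).
rewrite ballEmdist /= in ya.
by rewrite (le_lt_trans (metric_triangle y a z))// ltrD// metric_sym.
Qed.

(** An ultrafilter on a totally bounded set contains a ball of every radius, hence is Cauchy, and
    completeness gives its limit. *)
Lemma totally_bounded_compact_closure (A : set X) :
  complete_space X -> totally_bounded A -> compact (closure A).
Proof.
move=> cX /totally_bounded_closure tA; rewrite compact_ultra => F FU FA.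
have FC : cauchy F.
  apply: cauchy_exP => r r0; have [s sA] := tA r r0.
  have [||i _ Fi] := @ultra_bigcup_finite _ _ F [set` s] (ball ^~ r) FU.
  - exact: finite_seq.
  - exact: filterS sA FA.
  - by exists i.
have [x Fx] := cX F _ FC; exists x; split=> //.
apply: (closed_cvg (closure A) (@closed_closure _ A) FA).
exact: Fx.
Qed.

Lemma bounded_compact_closure (A : set X) : complete_space X -> doubling X ->
  metric_bounded A -> compact (closure A).
Proof.
by move=> cX dX bA; apply: totally_bounded_compact_closure => //;
  exact: bounded_totally_bounded.
Qed.

End Proper_spaces.

(** * The distances [d_M] and [d_inn] *)

Section Set_distances.
Context {R : realType} (X : metricType R).
Implicit Types (A B K Om : set X) (x y : X).

Lemma diam_leP A (r : R) :
  (diam A <= r%:E)%E <-> forall u v, A u -> A v -> mdist u v <= r.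
Proof.
split=> [/ereal_supP Ar u v Au Av|Ar].
  by rewrite -lee_fin; apply: Ar; exists (u, v).
by apply/ereal_supP => _ [[u v] /= [Au Av] <-]; rewrite lee_fin; exact: Ar.
Qed.

Lemma mdist_le_diam A x y : A x -> A y -> ((mdist x y)%:E <= diam A)%E.
Proof. by move=> Ax Ay; apply: ereal_sup_ubound; exists (x, y). Qed.

Lemma diam_ge0 A x : A x -> (0 <= diam A)%E.
Proof.
move=> Ax; apply: le_trans (mdist_le_diam Ax Ax).
by rewrite lee_fin mdist_ge0.
Qed.

Lemma diam_ltP A x (r : R) : A x -> (diam A < r%:E)%E ->
  exists2 s, s < r & forall u v, A u -> A v -> mdist u v <= s.
Proof.
move=> Ax Ar; have dA : diam A \is a fin_num.
  by rewrite ge0_fin_numE ?(diam_ge0 Ax)// (lt_trans Ar)// ltry.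
exists (fine (diam A)); first by rewrite -lte_fin fineK.
by apply/diam_leP; rewrite fineK.
Qed.

Lemma d_M_lt_ex Om x y (r : R) : (d_M Om x y < r%:E)%E ->
  exists K, [/\ connected K, K x, K y, K `<=` Om `|` [set x; y] &
    exists2 s, s < r & forall u v, K u -> K v -> mdist u v <= s].
Proof.
move=> /ereal_inf_lt[_ [K [cK Kx Ky KO] <-] Kr]; exists K; split=> //.
exact: diam_ltP Kx Kr.
Qed.

Lemma d_M_le Om K x y (s : R) : connected K -> K x -> K y ->
  K `<=` Om `|` [set x; y] -> (forall u v, K u -> K v -> mdist u v <= s) ->
  (d_M Om x y <= s%:E)%E.
Proof.
move=> cK Kx Ky KO Ks; apply: ge_ereal_inf; exists (diam K).
  by exists K.
exact/diam_leP.
Qed.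

Lemma d_M_le_sub Om K x y (s : R) : connected K -> K x -> K y -> K `<=` Om ->
  (forall u v, K u -> K v -> mdist u v <= s) -> (d_M Om x y <= s%:E)%E.
Proof.
by move=> cK Kx Ky KO; apply: d_M_le => // z Kz; left; exact: KO.
Qed.

Lemma mdist_le_d_M Om x y : ((mdist x y)%:E <= d_M Om x y)%E.
Proof.
apply/ereal_infP => _ [K [_ Kx Ky _] <-]; exact: mdist_le_diam.
Qed.

Lemma mdist_le_d_inn Om x y : ((mdist x y)%:E <= d_inn Om x y)%E.
Proof.
apply/ereal_infP => _ [a [b [g [[[ab _] _] <- <- _ ->]]]].
by apply: mdist_le_diam; [exists a|exists b] => //=; rewrite in_itv /= lexx ?andbT.
Qed.

Lemma d_M_subset Om x y : Om x -> Om y -> Om `|` [set x; y] `<=` Om.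
Proof. by move=> Ox Oy z [//|[->|->]]. Qed.

(** Stated for an abstract [d] so that [d_M] and [d_inn] share it; the lower bound by [mdist]
    provides nonnegativity. *)
Lemma dist_eq0P (d : X -> X -> \bar R) A B :
  (forall x y, ((mdist x y)%:E <= d x y)%E) ->
  ereal_inf [set d p.1 p.2 | p in A `*` B] = 0%E <->
  forall e : R, 0 < e -> exists a b, [/\ A a, B b & (d a b < e%:E)%E].
Proof.
move=> dge; split=> [d0 e e0|d0].
  have : (ereal_inf [set d p.1 p.2 | p in A `*` B] < e%:E)%E.
    by rewrite d0 lte_fin.
  by move=> /ereal_inf_lt[_ [[a b] /= [Aa Bb] <-] abe]; exists a, b.
apply/eqP; rewrite eq_le; apply/andP; split; last first.
  apply/ereal_infP => _ [p _ <-]; apply: le_trans (dge _ _).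
  by rewrite lee_fin mdist_ge0.
apply/lee_addgt0Pr => e e0; rewrite add0e; have [a [b [Aa Bb abe]]] := d0 e e0.
by apply: ge_ereal_inf; exists (d a b); [exists (a, b)|exact: ltW].
Qed.

Lemma dist_gt0P (d : X -> X -> \bar R) A B :
  (forall x y, ((mdist x y)%:E <= d x y)%E) ->
  (0 < ereal_inf [set d p.1 p.2 | p in A `*` B])%E <->
  exists2 e : R, 0 < e & forall a b, A a -> B b -> (e%:E <= d a b)%E.
Proof.
move=> dge; split=> [d0|[e e0 ed]].
  apply: contrapT => noe.
  suff d00 : ereal_inf [set d p.1 p.2 | p in A `*` B] = 0%E.
    by rewrite d00 ltxx in d0.
  apply/(dist_eq0P A B dge) => e e0; apply: contrapT => noab; apply: noe.
  exists e => // a b Aa Bb; rewrite leNgt; apply/negP => abe; apply: noab.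
  by exists a, b.
apply: (@lt_le_trans _ _ e%:E); first by rewrite lte_fin.
by apply/ereal_infP => _ [[a b] /= [Aa Bb] <-]; exact: ed.
Qed.

Lemma dist_M_eq0P Om A B : dist_M Om A B = 0%E <->
  forall e : R, 0 < e -> exists a b, [/\ A a, B b & (d_M Om a b < e%:E)%E].
Proof. exact: dist_eq0P (mdist_le_d_M _). Qed.

Lemma dist_M_gt0P Om A B : (0 < dist_M Om A B)%E <->
  exists2 e : R, 0 < e & forall a b, A a -> B b -> (e%:E <= d_M Om a b)%E.
Proof. exact: dist_gt0P (mdist_le_d_M _). Qed.

Lemma dist_inn_eq0P Om A B : dist_inn Om A B = 0%E <->
  forall e : R, 0 < e -> exists a b, [/\ A a, B b & (d_inn Om a b < e%:E)%E].
Proof. exact: dist_eq0P (mdist_le_d_inn _). Qed.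

End Set_distances.

(** * Rectifiable curves and the agreement of [d_inn] with [d_M] *)

Section Rectifiable_curves.
Context {R : realType} (X : metricType R).
Implicit Types (g : R -> X) (phi : R -> R) (N K Om : set X).

(* A curve has finite length iff its increments are dominated by those of a
   real function, and this condition is easy to concatenate. *)
Definition rectifiable_by (a b : R) g phi :=
  forall s t, a <= s -> s <= t -> t <= b -> mdist (g s) (g t) <= phi t - phi s.

Lemma path_sum_le (a b : R) g phi z (c : R) s : rectifiable_by a b g phi ->
  path <%R c s -> a <= c -> last c s <= b ->
  \sum_(0 <= i < size s) mdist (g (nth z (c :: s) i)) (g (nth z (c :: s) i.+1))
    <= phi (last c s) - phi c.
Proof.
move=> gphi; elim: s c => [|x s IH] c /=.
  by rewrite big_nil subrr.
move=> /andP[cx xs] ac lb; rewrite big_nat_recl//=.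
have ax : a <= x by rewrite (le_trans ac)// ltW.
have xb : x <= b.
  rewrite (le_trans _ lb)//; have /= := itv_partition_le (a := x) (b := last x s).
  by apply; split; [exact: xs|exact: eqxx].
have := gphi _ _ ac (ltW cx) xb; have := IH x xs ax lb; lra.
Qed.

Lemma curve_length_lty (a b c d : R) g phi : rectifiable_by a b g phi ->
  a <= c -> c <= d -> d <= b -> (curve_length c d g < +oo)%E.
Proof.
move=> gphi ac cd db; apply: (@le_lt_trans _ _ (phi d - phi c)%:E).
  apply/ereal_supP => _ [s [cs /eqP ls] <-]; rewrite lee_fin.
  by have := path_sum_le d gphi cs ac; rewrite ls; apply.
exact: ltry.
Qed.

Lemma curve_length_ge0 (a t : R) g : a <= t -> (0 <= curve_length a t g)%E.
Proof.
rewrite le_eqVlt => /orP[/eqP <-|at_].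
  by apply: ereal_sup_ubound; exists [::]; rewrite ?big_nil//; split=> /=.
apply: (@le_trans _ _ (mdist (g a) (g t))%:E); first by rewrite lee_fin mdist_ge0.
apply: ereal_sup_ubound; exists [:: t]; first exact: itv_partition1.
by rewrite /= big_nat1.
Qed.

Lemma curve_length_rcons (a s t : R) g : s < t ->
  (curve_length a s g + (mdist (g s) (g t))%:E <= curve_length a t g)%E.
Proof.
move=> st; rewrite -leeBrDr//; apply/ereal_supP => _ [l [al /eqP ls] <-].
rewrite leeBrDr// -EFinD; apply: ereal_sup_ubound; exists (rcons l t).
  by split; rewrite ?last_rcons// rcons_path al ls.
congr EFin; rewrite size_rcons big_nat_recr//=; congr (_ + _).
  apply: eq_big_nat => i /andP[_ il].
  rewrite -rcons_cons !nth_rcons /= ltnS (ltnW il) il.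
  by rewrite (set_nth_default s t) ?(set_nth_default s t (s := l))//= ltnS ltnW.
rewrite -rcons_cons !nth_rcons /= ltnSn ltnn eqxx.
by rewrite -[size l]/((size (a :: l)).-1) nth_last /= ls.
Qed.

(** [phi] is the arc length from [a]. Its increments dominate distances because a later point can be
    appended to any partition. *)
Lemma finite_length_rectifiable (a b : R) g : a <= b ->
  (curve_length a b g < +oo)%E ->
  exists2 phi, rectifiable_by a b g phi &
    (phi b - phi a)%:E = (curve_length a b g - curve_length a a g)%E.
Proof.
move=> ab fin.
have finl t : a <= t -> t <= b -> curve_length a t g \is a fin_num.
  move=> at_ tb; rewrite ge0_fin_numE ?curve_length_ge0//.
  move: tb; rewrite le_eqVlt => /orP[/eqP->//|tb].
  apply: le_lt_trans fin; apply: le_trans (curve_length_rcons a g tb).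
  by rewrite leeDl// lee_fin mdist_ge0.
exists (fun t => fine (curve_length a t g)); last first.
  by rewrite EFinB !fineK ?finl.
move=> s t as_ + tb; rewrite le_eqVlt => /orP[/eqP <-|st].
  by rewrite mdistxx subrr.
have sb : s <= b by rewrite (le_trans _ tb)// ltW.
have at_ : a <= t by rewrite (le_trans as_)// ltW.
rewrite lerBrDl -lee_fin EFinD !fineK ?finl//.
exact: curve_length_rcons.
Qed.

Definition rect_joined N (x y : X) := exists a b g phi,
  [/\ is_curve a b g, rectifiable_by a b g phi, g a = x, g b = y &
      forall t, a <= t <= b -> N (g t)].

Lemma rect_joined_subset N N' x y : N `<=` N' ->
  rect_joined N x y -> rect_joined N' x y.
Proof.
by move=> NN' [a [b [g [phi [gc gphi gx gy gN]]]]]; exists a, b, g, phi;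
  split=> // t /gN/NN'.
Qed.

Lemma rect_joined_trans N x y z :
  rect_joined N x y -> rect_joined N y z -> rect_joined N x z.
Proof.
move=> [a [b [g [phi [[ab gc] gphi gx gy gN]]]]].
move=> [a' [b' [g' [phi' [[ab' gc'] gphi' gx' gy' gN']]]]].
(* The second curve is shifted to start at time [b], and its dominating function is shifted to agree
   with [phi] there. *)
pose c := b + (b' - a').
pose h t := if t <= b then g t else g' (t - b + a').
pose psi t := if t <= b then phi t else phi' (t - b + a') - phi' a' + phi b.
have hb t : b <= t -> h t = g' (t - b + a').
  move=> bt; rewrite /h; have [tb|//] := leP t b.
  have -> : t = b by apply/eqP; rewrite eq_le tb bt.
  by rewrite subrr add0r gx' gy.
have psib t : b <= t -> psi t = phi' (t - b + a') - phi' a' + phi b.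
  move=> bt; rewrite /psi; have [tb|//] := leP t b.
  have -> : t = b by apply/eqP; rewrite eq_le tb bt.
  by rewrite subrr add0r subrr add0r.
have bc : b <= c by rewrite /c; lra.
have hpsi1 s t : a <= s -> s <= t -> t <= b -> mdist (h s) (h t) <= psi t - psi s.
  move=> as_ st tb; rewrite /h /psi tb (le_trans st tb); exact: gphi.
have hpsi2 s t : b <= s -> s <= t -> t <= c -> mdist (h s) (h t) <= psi t - psi s.
  move=> bs st tc; rewrite !hb ?psib ?(le_trans bs st)//.
  have := gphi' (s - b + a') (t - b + a'); rewrite /c in tc; lra.
have hpsi : rectifiable_by a c h psi.
  move=> s t as_ st tc; have [tb|bt] := leP t b; first exact: hpsi1.
  have [bs|sb] := leP b s; first exact: hpsi2.
  have := metric_triangle (h s) (h b) (h t).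
  have := hpsi1 s b as_ (ltW sb) (lexx b).
  have := hpsi2 b t (lexx b) (ltW bt) tc; lra.
exists a, c, h, psi; split=> //.
- split; first exact: le_trans bc.
  apply/continuous_itv_mdistP => t /andP[at_ tc] e e0.
  have [d1 d10 h1] : exists2 d : R, 0 < d & forall s, a <= s <= c -> s <= b ->
      `|t - s| < d -> mdist (h t) (h s) < e.
    have [tb|bt] := leP t b; last first.
      exists (t - b); first by rewrite subr_gt0.
      by move=> s _ sb; rewrite gtr0_norm; lra.
    have tab : a <= t <= b by rewrite at_.
    have [d d0 gd] := (continuous_itv_mdistP a b g).1 gc t tab e e0.
    exists d => // s /andP[as_ _] sb ts; rewrite /h tb sb; apply: gd => //.
    by rewrite as_.
  have [d2 d20 h2] : exists2 d : R, 0 < d & forall s, a <= s <= c -> b <= s ->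
      `|t - s| < d -> mdist (h t) (h s) < e.
    have [bt|tb] := leP b t; last first.
      exists (b - t); first by rewrite subr_gt0.
      by move=> s _ sb; rewrite ltr0_norm; lra.
    have tab : a' <= t - b + a' <= b' by rewrite /c in tc; lra.
    have [d d0 gd] := (continuous_itv_mdistP a' b' g').1 gc' _ tab e e0.
    exists d => // s /andP[_ sc] bs ts; rewrite !hb//; apply: gd => //.
      by rewrite /c in sc; lra.
    by have -> : t - b + a' - (s - b + a') = t - s by lra.
  exists (Num.min d1 d2); first by rewrite lt_min d10.
  move=> s sac; rewrite lt_min => /andP[td1 td2].
  by have [sb|/ltW bs] := leP s b; [exact: h1|exact: h2].
- by rewrite /h ab.
- by rewrite hb//; have -> : c - b + a' = b' by rewrite /c; lra.
- move=> t /andP[at_ tc]; rewrite /h; have [tb|bt] := leP t b.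
    by apply: gN; rewrite at_.
  by apply: gN'; rewrite /c in tc; lra.
Qed.

(** A point of a curve is no farther from the start than the length of the curve. *)
Lemma quasiconvex_joined : quasiconvex X -> exists2 C : R, 1 <= C &
  forall x y, rect_joined [set z | mdist x z <= C * mdist x y] x y.
Proof.
move=> [C C1 qC]; exists C => // x y; have [a [b [g [gc gx gy gl]]]] := qC x y.
have ab := gc.1.
have [||phi gphi phiE] := @finite_length_rectifiable a b g => //.
  exact: le_lt_trans gl (ltry _).
exists a, b, g, phi; split=> // t /andP[at_ tb] /=.
have mono s u : a <= s -> s <= u -> u <= b -> phi s <= phi u.
  move=> as_ su ub; rewrite -subr_ge0.
  exact: le_trans (mdist_ge0 _ _) (gphi _ _ as_ su ub).
rewrite -gx (le_trans (gphi _ _ (lexx a) at_ tb))//.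
rewrite (@le_trans _ _ (phi b - phi a))// ?lerD2r ?mono//.
rewrite gx -lee_fin phiE (le_trans _ gl)// leeBlDr.
  by rewrite leeDl// curve_length_ge0.
rewrite ge0_fin_numE ?curve_length_ge0//.
apply: (curve_length_lty gphi) => //.
Qed.

(** Being joined to [x] by a rectifiable curve in [Om] is locally constant along [K]. *)
Lemma open_joined Om K x y : quasiconvex X -> open Om -> K `<=` Om ->
  connected K -> K x -> K y -> rect_joined Om x y.
Proof.
move=> /quasiconvex_joined[C C1 qC] oO KO /connected_mdistP cK Kx Ky.
have loc k : Om k -> exists2 r : R, 0 < r & forall z, mdist k z < r ->
    rect_joined Om k z /\ rect_joined Om z k.
  move=> Ok; have [r r0 rO] := (open_mdistP Om).1 oO k Ok.
  have C0 : 0 < C + 1 by lra.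
  (* The curve from [k] to [z] stays within [C * mdist k z] of [k]; the one back stays that close to
     [z], hence within [(C + 1) * mdist k z] of [k]. *)
  exists (r / (C + 1)); first by rewrite divr_gt0.
  move=> z; rewrite ltr_pdivlMr// => kz; have := mdist_ge0 k z => kz0.
  split; apply: rect_joined_subset (qC _ _) => w /= wz; apply: rO; first nra.
  have := metric_triangle k z w; rewrite (metric_sym z k) in wz; nra.
apply: (cK (rect_joined Om x) _ x y) => //.
  move=> k Kk; have [r r0 rO] := loc k (KO _ Kk).
  exists r => // z Kz /rO[kz zk].
  by split=> xk; [exact: rect_joined_trans kz|exact: rect_joined_trans zk].
have [r r0 rO] := loc x (KO _ Kx).
by have [] := rO x; rewrite ?mdistxx.
Qed.

(** A curve is a connected set, which gives one direction. Conversely, [K] is replaced by a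
    rectifiable curve in a thin open neighbourhood of it. *)
Lemma d_inn_d_M Om x y (r : R) : quasiconvex X -> open Om -> Om x -> Om y ->
  (d_inn Om x y < r%:E)%E <-> (d_M Om x y < r%:E)%E.
Proof.
move=> qX oO Ox Oy; split.
  move=> /ereal_inf_lt[_ [a [b [g [[[ab gc] _] gx gy gO ->]]]]].
  apply: le_lt_trans; apply: ereal_inf_lbound; exists (g @` `[a, b]) => //.
  split.
  - exact: connected_continuous_connected (@segment_connected R a b) gc.
  - by exists a => //=; rewrite in_itv /= lexx.
  - by exists b => //=; rewrite in_itv /= lexx andbT.
  - by move=> z /gO; left.
move=> /d_M_lt_ex[K [cK Kx Ky /(_ _ _)/(@d_M_subset _ _ _ _ _ Ox Oy _) KO]].
move=> [s sr Ks].
(* Thickening by [e] raises the diameter bound to [s + 2 * e], which is still below [r]. *)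
pose e := (r - s) / 4; have e0 : 0 < e by rewrite /e; lra.
pose N := Om `&` [set z | exists2 k, K k & mdist k z < e].
have oN : open N.
  apply: openI => //; apply/open_mdistP => z [k Kk kz].
  have /open_mdistP/(_ z kz)[t t0 tP] := open_mdist_ball k e.
  by exists t => // w /tP kw; exists k.
have KN : K `<=` N.
  by move=> z Kz; split; [exact: KO|exists z => //; rewrite mdistxx].
have [a [b [g [phi [gc gphi gx gy gN]]]]] := open_joined qX oN KN cK Kx Ky.
apply: (@le_lt_trans _ _ (s + 2 * e)%:E); last by rewrite lte_fin /e; lra.
apply: ge_ereal_inf; exists (diam (g @` `[a, b])).
  exists a, b, g; split=> //.
    split=> // t _; exists 1 => // c d ac cd db _ _.
    exact: curve_length_lty gphi ac cd db.
  by move=> _ [t + <-]; rewrite /= in_itv => /gN[].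
apply/diam_leP => _ _ [t + <-] [u + <-]; rewrite /= !in_itv /=.
move=> /gN[_ [k Kk kt]] /gN[_ [l Kl lu]].
have := Ks k l Kk Kl; have := metric_triangle (g t) k (g u).
have := metric_triangle k l (g u); rewrite (metric_sym (g t) k); lra.
Qed.

Lemma dist_inn_eq0_M Om A B : quasiconvex X -> open Om -> A `<=` Om ->
  B `<=` Om -> dist_inn Om A B = 0%E <-> dist_M Om A B = 0%E.
Proof.
move=> qX oO AO BO; rewrite dist_inn_eq0P dist_M_eq0P.
by split=> AB e e0; have [a [b [Aa Bb ab]]] := AB e e0; exists a, b; split=> //;
  apply/(d_inn_d_M e qX oO (AO _ Aa) (BO _ Bb)).
Qed.

End Rectifiable_curves.

(** * Small connected pieces and uniform continuity *)

Section Small_connected_pieces.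
Context {R : realType} (X : metricType R).
Implicit Types (Om D V : set X).

(* Equivalently, for every [eta] the set [Om] is a finite union of connected
   sets of diameter at most [eta]: total boundedness for [d_M Om]. *)
Definition finely_connected Om := forall eta : R, 0 < eta ->
  forall F : set_system X, UltraFilter F -> F Om ->
  exists V, [/\ connected V, V `<=` Om, F V &
    forall u v, V u -> V v -> mdist u v <= eta].

Lemma radius_diam V (x : X) (r : R) : (forall u, V u -> mdist x u <= r) ->
  forall u v, V u -> V v -> mdist u v <= 2 * r.
Proof.
move=> Vr u v Vu Vv; have := Vr u Vu; have := Vr v Vv.
have := metric_triangle u x v; rewrite (metric_sym u x); lra.
Qed.

Lemma turning_finely_connected Om :
  bounded_turning Om -> totally_bounded Om -> finely_connected Om.
Proof.
(* Two points of [Om] in a ball of radius [r] lie in a continuum of diameter at most [2 * L * r], so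
   the union of such continua through [p] has diameter at most [4 * L * r = eta]. *)
move=> [L L1 tO] bO eta eta0 F FU FO; pose r := eta / (4 * L).
have L0 : 0 < L by lra.
have r0 : 0 < r by rewrite divr_gt0// mulr_gt0.
have rE : 4 * L * r = eta by rewrite /r mulrC divfK// gt_eqF// mulr_gt0.
have [s sO] := bO r r0.
have [||x _ Fx] := @ultra_bigcup_finite _ _ F [set` s] (ball ^~ r) FU.
- exact: finite_seq.
- exact: filterS sO FO.
have [p [Op xp]] := filter_ex (filterI FO Fx).
pose V := \bigcup_(K in [set K : set X | [/\ connected K, K p, K `<=` Om &
  forall u, K u -> mdist p u <= 2 * L * r]]) K.
exists V; split.
- apply: bigcup_connected; last by move=> K [].
  by exists p => K [].
- by move=> u [K [_ _ KO _] /KO].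
- apply: filterS (filterI FO Fx) => q [Oq xq].
  have [K [[_ cK] KO Kp Kq /diam_leP Kd]] := tO p q Op Oq.
  exists K => //; split=> // u Ku; rewrite (le_trans (Kd _ _ Kp Ku))//.
  rewrite !ballEmdist /= in xp xq.
  have := metric_triangle p x q; rewrite (metric_sym p x).
  have := mdist_ge0 p q; nra.
- move=> u v Vu Vv; rewrite -rE.
  have -> : 4 * L * r = 2 * (2 * L * r) by lra.
  by apply: (@radius_diam V p) => // w [K [_ _ _]]; exact.
Qed.

(** [V] is the component of [x] in the intersection of [D] with a closed ball; quasiconvexity gives
    curves to nearby points that do not leave this intersection. *)
Lemma quasiconvex_locally_connected D (x : X) (r : R) : quasiconvex X ->
  open D -> D x -> 0 < r -> exists V, [/\ connected V, V `<=` D,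
    nbhs x V & forall u, V u -> mdist x u <= r].
Proof.
move=> /quasiconvex_joined[C C1 qC] oD Dx r0.
have [s s0 sD] := (open_mdistP D).1 oD x Dx.
have t0 : 0 < Num.min r s by rewrite lt_min r0.
exists (connected_component (D `&` [set z | mdist x z <= r]) x); split.
- exact: component_connected.
- by move=> z /connected_component_sub[].
- apply/nbhs_mdistP; exists (Num.min r s / C); first by rewrite divr_gt0//; lra.
  move=> z; rewrite ltr_pdivlMr; last lra.
  rewrite mulrC lt_min => /andP[zr zs].
  have [a [b [g [phi [[ab gc] _ gx gz gN]]]]] := qC x z.
  exists (g @` `[a, b]).
    split.
    + by exists a => //=; rewrite in_itv /= lexx.
    + move=> _ [t + <-]; rewrite /= in_itv => /gN /= h; split.
        by apply: sD; exact: le_lt_trans zs.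
      by rewrite /= (le_trans h)// ltW.
    + exact: connected_continuous_connected (@segment_connected R a b) gc.
  by exists b => //=; rewrite in_itv /= lexx andbT.
- by move=> u /connected_component_sub[].
Qed.

(** By compactness the ultrafilter converges to some [y]. If [y] is in [D], local connectedness
    gives the piece; on the boundary, one of the finitely many components near [y] belongs to the
    ultrafilter. *)
Lemma finconn_finely_connected D : quasiconvex X -> open D ->
  compact (closure D) -> finitely_connected_at_boundary D -> finely_connected D.
Proof.
move=> qX oD; rewrite compact_ultra => cD fD eta eta0 F FU FD.
have [y [Dy Fy]] := cD F FU (filterS (@subset_closure _ D) FD).
have e0 : 0 < eta / 2 by rewrite divr_gt0.
have [{}Dy|nDy] := pselect (D y).
  have [V [cV VD yV Vr]] := quasiconvex_locally_connected qX oD Dy e0.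
  exists V; split=> //; first exact: Fy.
  have -> : eta = 2 * (eta / 2) by lra.
  exact: radius_diam Vr.
have fy : frontier D y by rewrite frontier_open.
have [U [[oU _] Uy Ub finU]] := fD y _ fy e0.
have [|V [u [Uu Du] <-] FV] := @ultra_bigcup_finite _ _ F _ id FU finU.
  apply: filterS (filterI (Fy _ (open_nbhs_nbhs (conj oU Uy))) FD) => z UDz.
  exists (connected_component (U `&` D) z); first by exists z.
  exact: connected_component_refl.
exists (connected_component (U `&` D) u); split=> //.
- exact: component_connected.
- by move=> z /connected_component_sub[].
- have -> : eta = 2 * (eta / 2) by lra.
  apply: (@radius_diam _ y) => z /connected_component_sub[/Ub + _].
  by rewrite ballEmdist /= => /ltW.
Qed.

End Small_connected_pieces.

(** * Uniform continuity for [d_M], and frontiers of images *)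

Section Transfer.
Context {R : realType} (X Y : metricType R).
Variables (Om : set X) (D : set Y) (f : X -> Y) (g : Y -> X).

Definition inverse_homeos := [/\ forall x, Om x -> D (f x),
  forall y, D y -> Om (g y), forall x, Om x -> g (f x) = x,
  forall y, D y -> f (g y) = y &
  {within Om, continuous f} /\ {within D, continuous g}].

Definition M_uniform := forall e : R, 0 < e -> exists2 d : R, 0 < d &
  forall a b, Om a -> Om b -> (d_M Om a b < d%:E)%E ->
    (d_M D (f a) (f b) < e%:E)%E.

(* If uniformity failed along pairs (a, b), an ultrafilter would put all the
   [f a] in one small connected set [V] and all the [f b] in another one [W];
   then [g V] and [g W] are at distance 0, hence so are [V] and [W]. *)
Lemma finely_connected_uniform : inverse_homeos -> finely_connected D ->
  (forall E F : set X, connected E -> connected F -> E `<` Om -> F `<` Om ->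
     dist_M Om E F = 0%E -> dist_M D (f @` E) (f @` F) = 0%E) ->
  M_uniform.
Proof.
move=> [fD gO gf fg [fc gc]] fcD fEF e e0; apply: contrapT => noD.
pose S (d : R) := [set p : X * X | [/\ Om p.1, Om p.2,
  (d_M Om p.1 p.2 < d%:E)%E & (e%:E <= d_M D (f p.1) (f p.2))%E]].
have S0 (d : R) : 0 < d -> S d !=set0.
  move=> d0; apply: contrapT => nS; apply: noD; exists d => // a b Oa Ob ab.
  rewrite ltNge; apply/negP => eab; apply: nS; exists (a, b); split=> //.
pose F0 := filter_from [set d : R | 0 < d] S.
have F0P : ProperFilter F0.
  apply: filter_from_proper; last exact: S0.
  apply: filter_from_filter; first by exists 1; rewrite /= ltr01.
  move=> d1 d2 /= d10 d20; exists (Num.min d1 d2); first by rewrite /= lt_min d10.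
  move=> p [Oa Ob ab eab]; split; split=> //; apply: lt_le_trans ab _.
    by rewrite lee_fin ge_min lexx.
  by rewrite lee_fin ge_min lexx orbT.
have [G [GU F0G]] := ultraFilterLemma F0P.
have GS (d : R) : 0 < d -> G (S d) by move=> d0; apply: F0G; exists d.
(* Two pieces and a connecting set, each of diameter at most [e / 8], lie within [e / 4] of one
   point, so their union has diameter at most [e / 2]. *)
have eta0 : 0 < e / 8 by rewrite divr_gt0.
have piece (h : X * X -> X) : (forall p, S 1 p -> Om (h p)) ->
    exists V, [/\ connected V, V `<=` D, G [set p | V (f (h p))] &
      forall u v, V u -> V v -> mdist u v <= e / 8].
  move=> hO; have [|V [cV VD GV Vd]] := fcD _ eta0 _ (ultra_fmap (f \o h) GU).
    change (G ((f \o h) @^-1` D)).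
    by apply: filterS (GS 1 ltr01) => p /hO/fD.
  by exists V.
have [V [cV VD GV Vd]] := piece fst (fun p Sp => let: And4 a _ _ _ := Sp in a).
have [W [cW WD GW Wd]] := piece snd (fun p Sp => let: And4 _ b _ _ := Sp in b).
have pick (d : R) : 0 < d -> exists a b, [/\ S d (a, b), V (f a) & W (f b)].
  move=> d0; have [[a b] [Sab [Va Wb]]] :=
    filter_ex (filterI (GS d d0) (filterI GV GW)).
  by exists a, b.
have [a [b [[/= Oa Ob _ eab] Va Wb]]] := pick 1 ltr01.
(* Class F speaks of proper subsets. A small connected [Z] whose preimage fills [Om] would contain
   both [f a] and [f b], against [eab]. *)
have notin Z : connected Z -> Z `<=` D ->
    (forall u v, Z u -> Z v -> mdist u v <= e / 8) -> ~ Om `<=` g @` Z.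
  move=> cZ ZD Zd OZ; have Zf x : Om x -> Z (f x).
    by move=> Ox; have [z Zz <-] := OZ x Ox; rewrite fg//; exact: ZD.
  have := d_M_le_sub cZ (Zf _ Oa) (Zf _ Ob) ZD Zd.
  by apply/negP; rewrite -ltNge; apply: lt_le_trans eab; rewrite lte_fin; lra.
have cg Z : connected Z -> Z `<=` D -> connected (g @` Z).
  move=> cZ ZD; apply: connected_continuous_connected => //.
  exact: continuous_subspaceW gc.
have gsub Z : connected Z -> Z `<=` D ->
    (forall u v, Z u -> Z v -> mdist u v <= e / 8) -> g @` Z `<` Om.
  move=> cZ ZD Zd; split; last exact: notin.
  by move=> _ [z /ZD/gO Ogz <-].
have fgK Z : Z `<=` D -> f @` (g @` Z) = Z.
  move=> ZD; apply/seteqP; split=> [_ [_ [z Zz <-] <-]|z Zz].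
    by rewrite fg//; exact: ZD.
  by exists (g z); [exists z|rewrite fg//; exact: ZD].
have : dist_M D V W = 0%E.
  rewrite -(fgK V VD) -(fgK W WD); apply: fEF.
  - exact: cg.
  - exact: cg.
  - exact: gsub.
  - exact: gsub.
  apply/dist_M_eq0P => d d0; have [a' [b' [[/= Oa' Ob' ab' _] Va' Wb']]] := pick d d0.
  exists a', b'; split=> //; first by exists (f a') => //; exact: gf.
  by exists (f b') => //; exact: gf.
move=> /dist_M_eq0P/(_ _ eta0)[v [w [Vv Ww]]].
move=> /d_M_lt_ex[K [cK Kv Kw]] /(_ _ _)/(d_M_subset (VD _ Vv) (WD _ Ww)) KD.
move=> [s se Ks].
have VKWd u : (V `|` (K `|` W)) u -> mdist v u <= e / 4.
  case=> [Vu|[Ku|Wu]]; first by have := Vd v u Vv Vu; lra.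
    by have := Ks v u Kv Ku; lra.
  have := Wd w u Ww Wu; have := Ks v w Kv Kw.
  have := metric_triangle v w u; lra.
have : (d_M D (f a) (f b) <= (2 * (e / 4))%:E)%E.
  apply: (@d_M_le_sub _ _ _ (V `|` (K `|` W))).
  - apply: connectedU => //; first by exists v; split=> //; left.
    by apply: connectedU => //; exists w.
  - by left.
  - by right; right.
  - by move=> u [/VD|[/KD|/WD]].
  - exact: radius_diam VKWd.
by move=> /(le_trans eab); rewrite lee_fin; lra.
Qed.

Lemma nbhs_within_preimage y (B : set X) : {within D, continuous g} ->
  open D -> D y -> nbhs (g y) B -> nbhs y [set w | D w /\ B (g w)].
Proof.
move=> /continuous_within_mdistP gc /open_mdistP oD Dy /nbhs_mdistP[e e0 eB].
have [d d0 dP] := gc y Dy e e0; have [r r0 rD] := oD y Dy.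
apply/nbhs_mdistP; exists (Num.min r d); first by rewrite lt_min r0.
move=> w; rewrite lt_min => /andP[/rD Dw yw]; split=> //; apply: eB.
exact: dP.
Qed.

Lemma closure_image A y : inverse_homeos -> open D -> A `<=` Om -> D y ->
  closure (f @` A) y -> closure A (g y).
Proof.
move=> [fD gO gf fg [fc gc]] oD AO Dy cy B.
move=> /(nbhs_within_preimage gc oD Dy)/cy[_ [[a Aa <-] [_]]].
by rewrite gf; [exists a|exact: AO].
Qed.

(** A homeomorphism matches frontiers inside the open domains; intersecting with [D] leaves out the
    boundary of [D], where continuity of [g] gives no control. *)
Lemma frontier_image A : inverse_homeos -> open D -> A `<=` Om ->
  D `&` frontier (f @` A) `<=` f @` (Om `&` frontier A).
Proof.
move=> fgP oD AO y [Dy [cy niy]]; have [fD gO gf fg [fc gc]] := fgP.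
exists (g y); last exact: fg; split; first exact: gO.
split; first exact: closure_image.
move=> iA; apply: niy.
apply: filterS (nbhs_within_preimage gc oD Dy iA) => w [Dw Agw].
by exists (g w) => //; exact: fg.
Qed.

End Transfer.

(** * Images of acceptable sets and of chains *)

Section Chain_transfer.
Context {R : realType} (X Y : metricType R).
Variables (Om : set X) (D : set Y) (f : X -> Y) (g : Y -> X).

Lemma inverse_homeos_sym : inverse_homeos Om D f g -> inverse_homeos D Om g f.
Proof. by case=> ? ? ? ? []. Qed.

(** The images of points of [A] tending to a boundary point [x] cluster at some [y] in the compact
    closure of [D]. If [y] were in [D], continuity of [g] would force [x = g y], a point of [Om]. *)
Lemma acceptable_image A : inverse_homeos Om D f g -> open Om -> open D ->
  compact (closure D) -> metric_bounded D ->
  acceptable Om A -> acceptable D (f @` A).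
Proof.
move=> fgP oO oD cD [M DM] [_ cA [AO nOA] [x [cx fx]]].
have [fD gO gf fg [fc gc]] := fgP.
have fAD : f @` A `<=` D by move=> _ [a /AO/fD ? <-].
split.
- by exists M => u v /fAD Du /fAD Dv; exact: DM.
- apply: connected_continuous_connected => //; exact: continuous_subspaceW fc.
- split=> // DA; apply: nOA => z Oz; have [a Aa az] := DA _ (fD _ Oz).
  by rewrite -(gf z Oz) -az gf//; exact: AO.
pose F := f @ within A (nbhs x).
have PF : ProperFilter F.
  by apply: fmap_proper_filter; exact: within_nbhs_proper.
have FA B : nbhs x B -> F (f @` (A `&` B)).
  move=> xB; change (nbhs x [set z | A z -> (f @` (A `&` B)) (f z)]).
  by apply: filterS xB => z Bz Az; exists z.
have [|y [cDy Fy]] := cD F PF.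
  apply: filterS (FA _ (filterT : nbhs x setT)) => _ [a [Aa _] <-].
  by apply/subset_closure/fAD; exists a.
exists y; split.
  move=> B yB; have [_ [[a [Aa _] <-] Bfa]] :=
    Fy _ _ (FA _ (filterT : nbhs x setT)) yB.
  by exists (f a); split=> //; exists a.
rewrite frontier_open//; split=> // Dy.
move: fx; rewrite frontier_open// => -[_ nOx].
have r0 : 0 < mdist x (g y) / 2.
  rewrite divr_gt0// mdist_gt0; apply/eqP => xgy.
  by apply: nOx; rewrite xgy; exact: gO.
have xB : nbhs x [set z | mdist x z < mdist x (g y) / 2].
  by apply/nbhs_mdistP; exists (mdist x (g y) / 2).
have gyB : nbhs (g y) [set z | mdist (g y) z < mdist x (g y) / 2].
  by apply/nbhs_mdistP; exists (mdist x (g y) / 2).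
have [_ [[a [Aa /= xa] <-] [_ /=]]] :=
  Fy _ _ (FA _ xB) (nbhs_within_preimage gc oD Dy gyB).
rewrite gf; last exact: AO.
have := metric_triangle x a (g y); rewrite (metric_sym a); lra.
Qed.

(** Uniformity of [g] keeps the frontiers apart, since close frontier points in [D] would have close
    preimages. A point of the impression inside [D] would be sent by [g] to a point of [Om] in the
    impression of [E], which is impossible. *)
Lemma chain_image E : inverse_homeos Om D f g -> M_uniform D Om g ->
  open Om -> open D -> compact (closure D) -> metric_bounded D ->
  chain Om E -> chain D (fun k => f @` E k).
Proof.
move=> fgP ug oO oD cD bD [aE nE dE iE].
have [fD gO gf fg [fc gc]] := fgP.
have EO k : E k `<=` Om by have [_ _ []] := aE k.
split.
- by move=> k; exact: acceptable_image.
- by move=> k _ [x /nE Ex <-]; exists x.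
- move=> k; have /dist_M_gt0P[e e0 eE] := dE k.
  have [d d0 dP] := ug e e0; apply/dist_M_gt0P; exists d => //.
  move=> a b /(frontier_image fgP oD (@EO _))[x [Ox fx] <-].
  move=> /(frontier_image fgP oD (@EO _))[z [Oz fz] <-].
  rewrite leNgt; apply/negP => /(dP _ _ (fD _ Ox) (fD _ Oz)).
  by rewrite !gf// ltNge eE.
- move=> y yE; rewrite frontier_open//; split.
    by apply: closureS (yE 0%N I) => _ [a /EO/fD ? <-].
  move=> Dy; have := gO _ Dy.
  have : frontier Om (g y).
    by apply: iE => k _; exact: (closure_image fgP oD (@EO k) Dy (yE k I)).
  by rewrite frontier_open// => -[].
Qed.

End Chain_transfer.

(** * Ends of a domain of bounded turning *)

Section Ends.
Context {R : realType} (X : metricType R).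
Implicit Types (Om A : set X) (E F S : nat -> set X).

Lemma divides_trans E F S : divides E F -> divides F S -> divides E S.
Proof.
move=> EF FS k; have [l FSk] := FS k; have [m EFl] := EF l.
by exists m => n /EFl EF'; apply: subset_trans EF' (FSk l _).
Qed.

Lemma nested_le E k l : (forall k, E k.+1 `<=` E k) -> (k <= l)%N ->
  E l `<=` E k.
Proof.
move=> nE; elim: l => [|l IH]; first by rewrite leqn0 => /eqP->; exact: subset_refl.
rewrite leq_eqVlt => /orP[/eqP->|/IH]; first exact: subset_refl.
exact: subset_trans (nE l).
Qed.

Lemma divides_nested E : (forall k, E k.+1 `<=` E k) -> divides E E.
Proof. by move=> nE k; exists k => l; exact: nested_le. Qed.

Lemma equivalent_sym E F : equivalent E F -> equivalent F E.
Proof. by case. Qed.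

Lemma equivalent_trans E F S :
  equivalent E F -> equivalent F S -> equivalent E S.
Proof.
by move=> [EF FE] [FS SF]; split; apply: (divides_trans (F := F)).
Qed.

Lemma divides_impression E F : divides E F -> impression E `<=` impression F.
Proof.
move=> EF x xE k _; have [l lE] := EF k.
exact: closureS (lE l (leqnn l)) _ (xE l I).
Qed.

Lemma equivalent_impression E F : equivalent E F -> impression E = impression F.
Proof. by move=> [EF FE]; apply/seteqP; split; exact: divides_impression. Qed.

Lemma end_of_eq Om E F : equivalent E F -> end_of Om E = end_of Om F.
Proof.
move=> EF; apply/seteqP; split=> S [cS SE]; split=> //.
  exact: equivalent_trans (equivalent_sym EF) SE.
exact: equivalent_trans EF SE.
Qed.

Lemma end_impression_end_of Om S E : chain Om E -> equivalent S E ->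
  end_impression (end_of Om S) = impression S.
Proof.
move=> cE SE; apply/seteqP; split=> [x [F [_ SF]]|x xS].
  by rewrite (equivalent_impression SF).
by exists E; [split|rewrite -(equivalent_impression SE)].
Qed.

(** A criterion for sequences [S] that are merely equivalent to a chain, such as [G_ Om x] and its
    image under [f]. *)
Lemma prime_end_of Om S E : chain Om E -> equivalent S E ->
  (forall A : nat -> set X, chain Om A -> divides A S -> divides S A) ->
  prime_ends Om (end_of Om S).
Proof.
move=> cE SE min; split; first by exists E => //; exact: end_of_eq.
move=> q [C cC ->] [A [B [[cA CA] [cB SB] AB]]].
have AS : divides A S by exact: divides_trans AB SB.2.
rewrite (end_of_eq Om CA); apply: end_of_eq; split=> //; exact: min.
Qed.

(** The nested sets generate a proper filter on a compact set, and its cluster points lie in the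
    impression. *)
Lemma chain_impression_nonempty Om E : compact (closure Om) -> chain Om E ->
  impression E !=set0.
Proof.
move=> cO [aE nE _ _]; pose F := filter_from [set: nat] E.
have PF : ProperFilter F.
  apply: filter_from_proper => [|k _].
    apply: filter_from_filter; first by exists 0%N.
    move=> i j _ _; exists (maxn i j) => // x Ex.
    by split; apply: (nested_le nE) Ex; rewrite ?leq_maxl ?leq_maxr.
  have [_ _ _ [x [cx _]]] := aE k.
  by have [z [Ez _]] := cx _ (filterT : nbhs x setT); exists z.
have [|x [_ Fx]] := cO F PF.
  exists 0%N => // x Ex; apply: subset_closure.
  by have [_ _ [EO _] _] := aE 0%N; exact: EO.
by exists x => k _ B xB; apply: Fx => //; exists k.
Qed.

End Ends.

(** * Prime ends at the boundary points of a domain of bounded turning *)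

Section Boundary_points.
Context {R : realType} (X : metricType R).
Variable Om : set X.
Hypothesis oO : open Om.
Hypothesis tO : bounded_turning Om.

Lemma turning_joined : exists2 L : R, 1 <= L & forall x y, Om x -> Om y ->
  exists K, [/\ connected K, K `<=` Om, K x, K y &
    forall u v, K u -> K v -> mdist u v <= L * mdist x y].
Proof.
have [L L1 tL] := tO; exists L => // x y Ox Oy.
by have [K [[_ cK] KO Kx Ky /diam_leP Kd]] := tL x y Ox Oy; exists K.
Qed.

(** A connected substitute for the trace of [ball x r] on [Om]: a component that, by bounded
    turning, contains all points of [Om] close to [x]. Its frontier in [Om] lies on the sphere of
    radius [r], because inside the ball nearby points of [Om] share a component. *)
Lemma connected_trace x (r : R) : closure Om x -> 0 < r ->
  exists sE : R * set X, [/\ 0 < sE.1, connected sE.2,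
    (forall z, Om z -> mdist x z < sE.1 -> sE.2 z),
    (forall z, sE.2 z -> Om z /\ mdist x z < r) &
    forall z, Om z -> frontier sE.2 z -> mdist x z = r].
Proof.
move=> cx r0; have [L L1 tL] := turning_joined.
have L0 : 0 < L by lra.
(* Points of [Om] within [s] of [x] are less than [2 * s] apart, so a continuum joining them stays
   within [s + 2 * L * s < r] of [x]. *)
pose s := r / (4 * L); have s0 : 0 < s by rewrite divr_gt0// mulr_gt0.
have sE : 4 * L * s = r by rewrite /s mulrC divfK// gt_eqF// mulr_gt0.
have [p Op xp] := (closure_mdistP _ _).1 cx s s0.
pose B := [set z | Om z /\ mdist x z < r].
have joined z w : Om z -> Om w -> mdist x z + L * mdist z w < r ->
    connected_component B z w.
  move=> Oz Ow zw; have [K [cK KO Kz Kw Kd]] := tL z w Oz Ow.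
  exists K => //; split=> // u Ku; split; first exact: KO.
  have := Kd z u Kz Ku; have := metric_triangle x z u; lra.
exists (s, connected_component B p); split=> //=.
- exact: component_connected.
- move=> z Oz xz; apply: joined => //.
  by have := metric_triangle p x z; rewrite (metric_sym p x); nra.
- by move=> z /connected_component_sub.
move=> z Oz [cz niz]; apply/eqP; rewrite eq_le; apply/andP; split.
  apply: (closure_mdist_le _ cz) => w /connected_component_sub[_]; exact: ltW.
rewrite leNgt; apply/negP => xz.
have [t t0 tO'] := (open_mdistP Om).1 oO z Oz.
(* The first bound keeps [w] in [Om], the second keeps the continuum from [z] to [w] inside the
   ball. *)
pose d := Num.min t ((r - mdist x z) / L).
have d0 : 0 < d by rewrite lt_min t0 divr_gt0// subr_gt0.
have near w : mdist z w < d -> connected_component B z w.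
  rewrite lt_min ltr_pdivlMr// => /andP[/tO' Ow zw].
  by apply: joined => //; lra.
have [w pw zw] := (closure_mdistP _ _).1 cz d d0.
have pz : connected_component B p z.
  apply: connected_component_trans pw _.
  exact/connected_component_sym/near.
apply: niz; apply/nbhs_mdistP; exists d => // u /near.
exact: connected_component_trans.
Qed.

Lemma inv_nat_lt (r : R) : 0 < r ->
  exists k, forall l, (k <= l)%N -> l.+1%:R^-1 < r.
Proof.
move=> r0; exists (Num.truncn r^-1) => l kl.
rewrite -[ltRHS]invrK ltf_pV2 ?posrE ?invr_gt0//.
by rewrite (lt_le_trans (truncnS_gt _))// ler_nat ltnS.
Qed.

Lemma G_closure x l z : closure (G_ Om x l) z -> mdist x z <= l.+1%:R^-1.
Proof.
by apply: closure_mdist_le => w [+ _]; rewrite ballEmdist => /ltW.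
Qed.

Lemma closure_G x l : closure Om x -> closure (G_ Om x l) x.
Proof.
move=> /closure_mdistP cx; apply/closure_mdistP => e e0.
have [|a Oa] := cx (Num.min e l.+1%:R^-1); first by rewrite lt_min e0 invr_gt0 ltr0n.
rewrite lt_min => /andP[xe xl]; exists a => //; split=> //.
by rewrite ballEmdist.
Qed.

Lemma G_impression x : closure Om x -> impression (G_ Om x) = [set x].
Proof.
move=> cx; apply/seteqP; split=> [z zG|_ -> k _]; last exact: closure_G.
apply/esym/mdist_positivity/eqP; rewrite eq_le mdist_ge0 andbT leNgt.
apply/negP => /inv_nat_lt[k /(_ k (leqnn k))]; rewrite ltNge G_closure//.
exact: zG.
Qed.

(** The chain consists of connected traces at radii tending to 0. Consecutive frontiers lie on
    spheres of different radii about [x], hence at positive distance. *)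
Lemma G_chain x : frontier Om x ->
  exists2 E, chain Om E & equivalent (G_ Om x) E.
Proof.
rewrite frontier_open// => -[cx nOx].
have [p Op _] := (closure_mdistP _ _).1 cx 1 ltr01.
(* Starting from the distance to a point [p] of [Om] keeps [p] out of every [E k], so each [E k] is
   a proper subset. *)
pose r0 := mdist x p.
have r00 : 0 < r0 by rewrite mdist_gt0; apply/eqP => xp; rewrite xp in nOx.
have /choice[T TP] : forall r : R, exists sE : R * set X, 0 < r ->
    [/\ 0 < sE.1, connected sE.2,
    (forall z, Om z -> mdist x z < sE.1 -> sE.2 z),
    (forall z, sE.2 z -> Om z /\ mdist x z < r) &
    forall z, Om z -> frontier sE.2 z -> mdist x z = r].
  move=> r; have [rp|_] := ltP 0 r; last by exists (0, set0).
  by have [sE sEP] := connected_trace cx rp; exists sE.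
(* The first term puts [E k.+1] inside [E k]; the second makes the radii decrease strictly to 0. *)
pose rad k := iter k (fun r => Num.min (T r).1 (r / 2)) r0.
pose E k := (T (rad k)).2.
have radS k : rad k.+1 = Num.min (T (rad k)).1 (rad k / 2) by [].
have rad0 k : 0 < rad k.
  elim: k => [//|k IH]; rewrite radS lt_min divr_gt0// andbT.
  by have [] := TP _ IH.
have EB k z : E k z -> Om z /\ mdist x z < rad k.
  by have [_ _ _ h _] := TP _ (rad0 k); exact: h.
have BE k z : Om z -> mdist x z < (T (rad k)).1 -> E k z.
  by have [_ _ h _ _] := TP _ (rad0 k); exact: h.
have nE k : E k.+1 `<=` E k.
  by move=> z /EB[Oz]; rewrite radS lt_min => /andP[xz _]; exact: BE.
have small e : 0 < e -> exists k, rad k < e.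
  move=> e0; have [n ne] := halving_lt r00 e0; exists n.
  apply: le_lt_trans ne; elim: n => [|n IH]; first by rewrite divr1.
  by rewrite radS ge_min exprSr invfM mulrA ler_pM2r ?IH ?orbT.
have cE k : closure (E k) x.
  apply/closure_mdistP => e e0; have [s0 _ _ _ _] := TP _ (rad0 k).
  have [|a Oa] := (closure_mdistP _ _).1 cx (Num.min e (T (rad k)).1).
    by rewrite lt_min e0.
  by rewrite lt_min => /andP[xe xs]; exists a => //; exact: BE.
have E0p k : ~ E k p.
  by move=> /(nested_le nE (leq0n k))/EB[_]; rewrite ltxx.
exists E; split.
- move=> k; split.
  + exists (2 * rad k); apply: (radius_diam (x := x)) => u /EB[_]; exact: ltW.
  + by have [] := TP _ (rad0 k).
  + by split=> [z /EB[]//|/(_ p Op)]; exact: E0p.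
  + by exists x; split=> //; rewrite frontier_open.
- exact: nE.
- move=> k; apply/dist_M_gt0P; exists (rad k - rad k.+1).
    by rewrite subr_gt0 radS gt_min; apply/orP; right; have := rad0 k; lra.
  move=> a b [Oa fa] [Ob fb]; apply: le_trans (mdist_le_d_M _ _ _).
  have [_ _ _ _ /(_ b Ob fb) <-] := TP _ (rad0 k).
  have [_ _ _ _ /(_ a Oa fa) <-] := TP _ (rad0 k.+1).
  by rewrite lee_fin; have := metric_triangle x a b; lra.
- move=> z zE; suff -> : z = x by rewrite frontier_open.
  apply/esym/mdist_positivity/eqP; rewrite eq_le mdist_ge0 andbT leNgt.
  apply/negP => /small[k]; rewrite ltNge => /negP; apply.
  by apply: closure_mdist_le (zE k I) => w /EB[_]; exact: ltW.
- move=> k; have [s0 _ _ _ _] := TP _ (rad0 k).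
  have [l0 l0P] := inv_nat_lt s0; exists l0 => l /l0P ls z [+ Oz].
  by rewrite ballEmdist /= => xz; apply: BE => //; exact: lt_trans ls.
- move=> k; have [|j jk] := small k.+1%:R^-1; first by rewrite invr_gt0.
  exists j => l jl z /(nested_le nE jl)/EB[Oz xz]; split=> //.
  by rewrite ballEmdist /=; exact: lt_trans jk.
Qed.

(* Otherwise short continua would join points of [E k.+1] to points outside
   [E k], hence cross both frontiers. *)
Lemma G_divides_chain x E : chain Om E -> impression E x ->
  divides (G_ Om x) E.
Proof.
move=> [aE nE dE _] xE k; have [L L1 tL] := turning_joined.
have L0 : 0 < L by lra.
have /dist_M_gt0P[e e0 eE] := dE k.
(* [w] and [z] are less than [2 * s] apart, so [K] has diameter below [2 * L * s = e / 2]. *)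
pose s := e / (4 * L); have s0 : 0 < s by rewrite divr_gt0// mulr_gt0.
have sE : 4 * L * s = e by rewrite /s mulrC divfK// gt_eqF// mulr_gt0.
have [l0 l0P] := inv_nat_lt s0; exists l0 => l /l0P ls z [+ Oz].
rewrite ballEmdist /= => /lt_trans/(_ ls) xz; apply: contrapT => nEz.
have EO j : E j `<=` Om by have [_ _ []] := aE j.
have [w Ew xw] := (closure_mdistP _ _).1 (xE k.+1 I) s s0.
have [K [cK KO Kw Kz Kd]] := tL w z (EO _ _ Ew) Oz.
have [a Ka fa] := connected_meets_frontier KO cK
  (ex_intro2 _ _ w Kw Ew) (ex_intro2 _ _ z Kz (fun h => nEz (nE _ _ h))).
have [b Kb fb] := connected_meets_frontier KO cK
  (ex_intro2 _ _ w Kw (nE _ _ Ew)) (ex_intro2 _ _ z Kz nEz).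
have := le_trans (eE a b fa fb) (d_M_le_sub cK Ka Kb KO Kd).
rewrite lee_fin => eL.
have wz : mdist w z < 2 * s.
  by have := metric_triangle w x z; rewrite (metric_sym w x); lra.
nra.
Qed.

(** The nonempty impression of [E] is contained in that of [G_ Om x], which is the single point [x];
    so [x] is in the impression of [E]. *)
Lemma chain_at_boundary_minimal x (E : nat -> set X) : compact (closure Om) ->
  closure Om x -> chain Om E -> divides E (G_ Om x) -> divides (G_ Om x) E.
Proof.
move=> cO cx cE EG; apply: G_divides_chain => //.
have [z zE] := chain_impression_nonempty cO cE.
by have := divides_impression EG zE; rewrite G_impression// => <-.
Qed.

Lemma prime_end_G x : compact (closure Om) -> frontier Om x ->
  prime_ends Om (end_of Om (G_ Om x)).
Proof.
move=> cO fx; have [E cE GE] := G_chain fx; apply: prime_end_of cE GE _ => A cA.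
by apply: chain_at_boundary_minimal => //; case: fx.
Qed.

Lemma end_impression_G x : frontier Om x ->
  end_impression (end_of Om (G_ Om x)) = [set x].
Proof.
move=> fx; have [E cE GE] := G_chain fx.
by rewrite (end_impression_end_of cE GE) G_impression//; case: fx.
Qed.

(** The end of [G_ Om x] divides every end with [x] in its impression, and a prime end is divided by
    no other end. *)
Lemma prime_end_unique p x : frontier Om x -> prime_ends Om p ->
  end_impression p x -> p = end_of Om (G_ Om x).
Proof.
move=> fx [[C cC pC] minp] [A pA xA]; have [E cE GE] := G_chain fx.
have [cA CA] : end_of Om C A by rewrite -pC.
symmetry; apply: minp; first by exists E => //; exact: end_of_eq.
exists E, A; split=> //; apply: divides_trans GE.2 _.
exact: G_divides_chain.
Qed.

Lemma mdist_d_M_uniform (e : R) : 0 < e -> exists2 d : R, 0 < d &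
  forall a b, Om a -> Om b -> mdist a b < d -> (d_M Om a b < e%:E)%E.
Proof.
move=> e0; have [L L1 tL] := turning_joined; have L0 : 0 < L by lra.
exists (e / L); first by rewrite divr_gt0.
move=> a b Oa Ob; rewrite ltr_pdivlMr// mulrC => ab.
have [K [cK KO Ka Kb Kd]] := tL a b Oa Ob.
by apply: le_lt_trans (d_M_le_sub cK Ka Kb KO Kd) _; rewrite lte_fin.
Qed.

End Boundary_points.

(** * The extension to the closure *)

Section Extension.
Context {R : realType} (X Y : metricType R).
Variables (Om : set X) (D : set Y) (f : X -> Y) (g : Y -> X).
Hypotheses (oO : open Om) (oD : open D) (tO : bounded_turning Om).
Hypotheses (cO : compact (closure Om)) (cD : compact (closure D)).
Hypotheses (bO : metric_bounded Om) (bD : metric_bounded D).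
Hypothesis fgP : inverse_homeos Om D f g.
Hypotheses (uf : M_uniform Om D f) (ug : M_uniform D Om g).

Let fD x : Om x -> D (f x). Proof. by case: fgP => h *; exact: h. Qed.
Let gO y : D y -> Om (g y). Proof. by case: fgP => _ h *; exact: h. Qed.
Let gf x : Om x -> g (f x) = x. Proof. by case: fgP => _ _ h *; exact: h. Qed.
Let fg y : D y -> f (g y) = y. Proof. by case: fgP => _ _ _ h *; exact: h. Qed.

Let fG x k := f @` G_ Om x k.

Lemma divides_image {T U : metricType R} (h : T -> U) (E F : nat -> set T) :
  divides E F -> divides (fun k => h @` E k) (fun k => h @` F k).
Proof.
by move=> EF k; have [l lE] := EF k; exists l => m /lE; exact: image_subset.
Qed.

Lemma equivalent_image {T U : metricType R} (h : T -> U) (E F : nat -> set T) :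
  equivalent E F -> equivalent (fun k => h @` E k) (fun k => h @` F k).
Proof. by move=> [EF FE]; split; exact: divides_image. Qed.

Lemma image_preimage_chain (A : nat -> set Y) : (forall k, A k `<=` D) ->
  (fun k => f @` (g @` A k)) = A.
Proof.
move=> AD; apply/funext => k; apply/seteqP; split.
  by move=> _ [_ [y Ay <-] <-]; rewrite fg//; exact: AD Ay.
by move=> y Ay; exists (g y); [exists y|rewrite fg//; exact: AD Ay].
Qed.

Lemma preimage_image_G x : (fun k => g @` fG x k) = G_ Om x.
Proof.
apply/funext => k; apply/seteqP; split.
  by move=> _ [_ [z [xz Oz] <-] <-]; rewrite gf.
by move=> z [xz Oz]; exists (f z); [exists z|rewrite gf].
Qed.

Lemma chain_preimage (A : nat -> set Y) :
  chain D A -> chain Om (fun k => g @` A k).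
Proof.
move=> cA; apply: (chain_image (inverse_homeos_sym fgP)) => //.
Qed.

Lemma fG_chain x : frontier Om x -> exists E, [/\ chain Om E,
  equivalent (G_ Om x) E, chain D (fun k => f @` E k) &
  equivalent (fG x) (fun k => f @` E k)].
Proof.
move=> fx; have [E cE GE] := G_chain oO tO fx.
exists E; split=> //; last exact: equivalent_image.
exact: (chain_image fgP).
Qed.

(** A chain dividing [fG x] is pulled back by [g] to one dividing [G_ Om x]; minimality there is
    carried over by [f]. *)
Lemma prime_end_fG x : frontier Om x -> prime_ends D (end_of D (fG x)).
Proof.
move=> fx; have [E [cE GE cfE GfE]] := fG_chain fx.
apply: prime_end_of cfE GfE _ => A cA AfG.
have AD k : A k `<=` D by have [/(_ k)[_ _ []]] := cA.
rewrite -(image_preimage_chain AD); apply: divides_image.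
apply: chain_at_boundary_minimal => //; first by case: fx.
  exact: chain_preimage.
by rewrite -preimage_image_G; exact: divides_image.
Qed.

(** Pulled back by [g], a chain of [p] has a boundary point [x] in its impression and is divided by
    [G_ Om x]. Applying [f], the end of [fG x] divides [p], and primality gives equality. *)
Lemma prime_end_is_fG p : prime_ends D p ->
  exists2 x, frontier Om x & p = end_of D (fG x).
Proof.
move=> [[A cA pA] minp]; have cgA := chain_preimage cA.
have AD k : A k `<=` D by have [/(_ k)[_ _ []]] := cA.
have [x xA] := chain_impression_nonempty cO cgA.
have fx : frontier Om x by case: cgA => _ _ _; exact.
exists x => //; have [E [cE GE cfE GfE]] := fG_chain fx.
symmetry; apply: minp; first by exists (fun k => f @` E k) => //; exact: end_of_eq.
exists (fun k => f @` E k), A; split=> //.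
  rewrite pA; split=> //; split; apply: divides_nested; by case: cA.
rewrite -(image_preimage_chain AD); apply: divides_image.
apply: divides_trans GE.2 _; exact: G_divides_chain.
Qed.

(** Applying [g] gives the equivalence of [G_ Om x] and [G_ Om x'], whose impressions are single
    points. *)
Lemma end_fG_inj x x' : frontier Om x -> frontier Om x' ->
  end_of D (fG x) = end_of D (fG x') -> x = x'.
Proof.
move=> fx fx' xx'; have [E [_ _ cfE GfE]] := fG_chain fx.
have [_ GfE'] : end_of D (fG x') (fun k => f @` E k) by rewrite -xx'.
have /(equivalent_image g) := equivalent_trans GfE (equivalent_sym GfE').
rewrite !preimage_image_G => /equivalent_impression.
rewrite !G_impression; [|by case: fx'|by case: fx].
by move=> xx; have : [set x] x by []; rewrite xx.
Qed.

(** Points outside [closure Om] fall into the second branch as a default. *)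
Definition extension x : Y + set (nat -> set Y) :=
  if pselect (Om x) then inl (f x) else inr (end_of D (fG x)).

Lemma extensionO x : Om x -> extension x = inl (f x).
Proof. by rewrite /extension; case: pselect. Qed.

Lemma extension_frontier x : frontier Om x ->
  extension x = inr (end_of D (fG x)).
Proof.
by rewrite frontier_open// => -[_ nO]; rewrite /extension; case: pselect.
Qed.

Lemma closure_cases x : closure Om x -> Om x \/ frontier Om x.
Proof.
by move=> cx; have [|nO] := pselect (Om x); [left|right; rewrite frontier_open].
Qed.

Lemma extension_bij : set_bij (closure Om) (prime_closure D) extension.
Proof.
split.
- move=> x /closure_cases[Ox|fx]; first by rewrite extensionO//; exact: fD.
  by rewrite extension_frontier//; exact: prime_end_fG.
- move=> x x'; rewrite !inE.
  move=> /closure_cases[Ox|fx] /closure_cases[Ox'|fx'].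
  + by rewrite !extensionO// => -[/(congr1 g)]; rewrite !gf.
  + by rewrite extensionO// extension_frontier.
  + by rewrite extension_frontier// extensionO.
  + by rewrite !extension_frontier// => -[]; exact: end_fG_inj.
- move=> [y /= Dy|p /= /prime_end_is_fG[x fx ->]].
    exists (g y); first by apply: subset_closure; exact: gO.
    by rewrite extensionO ?fg//; exact: gO.
  by exists x; [case: fx|rewrite extension_frontier].
Qed.

(** Treats interior and boundary points alike, so that the continuity estimate needs no case
    distinction. *)
Lemma impression_extension_sub z (r : R) : closure Om z -> 0 < r ->
  impression_of (extension z) `<=`
    closure (f @` [set w | Om w /\ mdist z w < r]).
Proof.
move=> /closure_cases[Oz|fz] r0 y.
  rewrite extensionO// => ->; apply: subset_closure; exists z => //.
  by split=> //; rewrite mdistxx.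
have [E [_ _ cfE GfE]] := fG_chain fz.
rewrite extension_frontier//= (end_impression_end_of cfE GfE) => yG.
have [k /(_ k (leqnn k)) kr] := inv_nat_lt r0.
apply: closureS (yG k I) => _ [w [zw Ow] <-]; exists w => //; split=> //.
by rewrite ballEmdist /= in zw; exact: lt_trans kr.
Qed.

Lemma impression_extension_nonempty z : closure Om z ->
  impression_of (extension z) !=set0.
Proof.
move=> /closure_cases[Oz|fz]; first by rewrite extensionO//; exists (f z).
have [E [_ _ cfE GfE]] := fG_chain fz.
rewrite extension_frontier//= (end_impression_end_of cfE GfE).
rewrite (equivalent_impression GfE); exact: chain_impression_nonempty cfE.
Qed.

(** The image of a connected trace [T] at [x] is connected and of diameter at most [e]. Both [u] and
    [v] lie in its closure, so adding them preserves this and yields a set admissible for [d_M]. *)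
Lemma impression_extension_close x (e : R) : closure Om x -> 0 < e ->
  exists2 d : R, 0 < d & forall z u v, closure Om z -> mdist x z < d ->
    impression_of (extension x) u -> impression_of (extension z) v ->
    (d_M D u v <= e%:E)%E.
Proof.
move=> cx e0; have [d d0 dP] := uf e0.
have [d' d'0 d'P] := mdist_d_M_uniform tO d0.
have r0 : 0 < d' / 2 by rewrite divr_gt0.
have [[s T] [/= s0 cT sT Tr _]] := connected_trace oO tO cx r0.
(* Points within [s / 2] of such a [z] are within [s] of [x], where [T] contains all of [Om]. *)
exists (s / 2); first by rewrite divr_gt0.
have TO : T `<=` Om by move=> w /Tr[].
have fTd a b : (f @` T) a -> (f @` T) b -> mdist a b <= e.
  move=> [w Tw <-] [w' Tw' <-]; apply/ltW; rewrite -lte_fin.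
  apply: le_lt_trans (mdist_le_d_M D _ _) _; apply: dP; [exact: TO|exact: TO|].
  apply: d'P; [exact: TO|exact: TO|].
  have [_ xw] := Tr w Tw; have [_ xw'] := Tr w' Tw'.
  by have := metric_triangle w x w'; rewrite (metric_sym w x); lra.
move=> z u v cz xz uI vI.
have cu : closure (f @` T) u.
  apply: closureS (impression_extension_sub cx s0 uI) => _ [w [Ow xw] <-].
  by exists w => //; exact: sT.
have s20 : 0 < s / 2 by rewrite divr_gt0.
have cv : closure (f @` T) v.
  apply: closureS (impression_extension_sub cz s20 vI) => _ [w [Ow zw] <-].
  by exists w => //; apply: sT => //; have := metric_triangle x z w; lra.
have sub : f @` T `|` [set u; v] `<=` closure (f @` T).
  by move=> w [/subset_closure//|[->|->]].
apply: (@d_M_le _ _ _ (f @` T `|` [set u; v])).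
- apply: (connected_between _ _ sub); last by move=> w; left.
  have [_ _ _ _ [fc _]] := fgP.
  by apply: connected_continuous_connected => //; exact: continuous_subspaceW fc.
- by right; left.
- by right; right.
- by move=> w [[t /TO/fD ? <-]|]; [left|right].
- by move=> a b /sub ca /sub cb; exact: closure_diam_le fTd _ _ ca cb.
Qed.

Lemma impression_extension_singleton x u v : closure Om x ->
  impression_of (extension x) u -> impression_of (extension x) v -> u = v.
Proof.
move=> cx uI vI; apply/mdist_positivity/eqP; rewrite eq_le mdist_ge0 andbT.
apply/ler_addgt0Pl => e e0; rewrite addr0.
have [d d0 dP] := impression_extension_close cx e0.
rewrite -lee_fin (le_trans (mdist_le_d_M D u v))//.
by apply: dP uI vI => //; rewrite mdistxx.
Qed.

Lemma extension_continuous_M x (e : R) : closure Om x -> 0 < e ->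
  exists2 d : R, 0 < d & forall z, closure Om z -> mdist x z < d ->
    (dist_M_star D (extension x) (extension z) < e%:E)%E.
Proof.
move=> cx e0; have e20 : 0 < e / 2 by rewrite divr_gt0.
have [d d0 dP] := impression_extension_close cx e20.
exists d => // z cz xz.
have [u uI] := impression_extension_nonempty cx.
have [v vI] := impression_extension_nonempty cz.
apply: (@le_lt_trans _ _ (e / 2)%:E); last by rewrite lte_fin; lra.
apply: le_trans (dP z u v cz xz uI vI).
by apply: ereal_inf_lbound; exists (u, v).
Qed.

(** By compactness, counterexamples at distance at least [e] from [x] accumulate at some [z] whose
    value has the same one-point impression as that of [x]. Separation and injectivity give [z = x],
    a contradiction. *)
Lemma extension_inverse_continuous_M x (e : R) : closure Om x ->
  (forall v, prime_closure D v ->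
     dist_M_star D (extension x) v = 0%E -> v = extension x) -> 0 < e ->
  exists2 d : R, 0 < d & forall z, closure Om z ->
    (dist_M_star D (extension x) (extension z) < d%:E)%E -> mdist x z < e.
Proof.
move=> cx sep e0; apply: contrapT => nod.
pose S (d : R) := [set z | [/\ closure Om z, e <= mdist x z &
  (dist_M_star D (extension x) (extension z) < d%:E)%E]].
pose F := filter_from [set d : R | 0 < d] S.
have PF : ProperFilter F.
  apply: filter_from_proper => [|d d0].
    apply: filter_from_filter; first by exists 1; rewrite /= ltr01.
    move=> d1 d2 /= d10 d20; exists (Num.min d1 d2).
      by rewrite /= lt_min d10.
    move=> z [cz ez zd]; split; split=> //; apply: lt_le_trans zd _.
      by rewrite lee_fin ge_min lexx.
    by rewrite lee_fin ge_min lexx orbT.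
  apply: contrapT => nS; apply: nod; exists d => // z cz zd.
  by rewrite ltNge; apply/negP => ez; apply: nS; exists z.
have [|z [cz Fz]] := cO PF.
  by exists 1; [rewrite /= ltr01|move=> z []].
have FS (d : R) (B : set X) : 0 < d -> nbhs z B -> S d `&` B !=set0.
  by move=> d0 zB; apply: Fz => //; exists d.
have near (d : R) : 0 < d -> nbhs z [set w | mdist z w < d].
  by move=> d0; apply/nbhs_mdistP; exists d.
have [u uI] := impression_extension_nonempty cx.
have [v vI] := impression_extension_nonempty cz.
(* A point [b] of the impression at some [w] near [z] is within [t / 2] of both [u] and [v]. *)
have uv : u = v.
  apply/mdist_positivity/eqP; rewrite eq_le mdist_ge0 andbT.
  apply/ler_addgt0Pl => t t0; rewrite addr0.
  have t20 : 0 < t / 2 by rewrite divr_gt0.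
  have [d d0 dP] := impression_extension_close cz t20.
  have [w [[cw _ xw] /= zw]] := FS _ _ t20 (near d d0).
  have [_ [[a b] /= [aI bI] <-] abt] := ereal_inf_lt xw.
  have := le_lt_trans (mdist_le_d_M D a b) abt.
  have := le_trans (mdist_le_d_M D v b) (dP w v b cw zw vI bI).
  rewrite lee_fin lte_fin (impression_extension_singleton cx aI uI).
  by have := metric_triangle u b v; rewrite (metric_sym b v); lra.
have xz0 : dist_M_star D (extension x) (extension z) = 0%E.
  apply/dist_M_eq0P => t t0; exists u, v; split=> //.
  apply: (@le_lt_trans _ _ 0%:E); last by rewrite lte_fin.
  rewrite -uv; apply: (@d_M_le _ _ _ [set u]) => //.
  - exact: connected1.
  - by move=> w ->; right; left.
  - by move=> a b -> ->; rewrite mdistxx.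
have [extD extinj _] := extension_bij.
have /extinj : extension z = extension x by apply: sep => //; exact: extD.
rewrite !inE => /(_ cz cx) zx.
have e20 : 0 < e / 2 by rewrite divr_gt0.
have [w [[_ ew _] /= zw]] := FS 1 _ ltr01 (near _ e20).
by move: zw; rewrite zx; lra.
Qed.

Lemma extension_open_preimage U : prime_end_open D U ->
  exists2 V : set X, open V &
    closure Om `&` extension @^-1` U = closure Om `&` V.
Proof.
move=> [UD Uin Uend].
have loc x : closure Om x -> U (extension x) -> exists2 r : R, 0 < r &
    forall z, closure Om z -> mdist x z < r -> U (extension z).
  move=> /closure_cases[Ox|fx].
    rewrite extensionO// => /Uin Ux.
    have [_ _ _ _ [fc _]] := fgP.
    have /nbhs_mdistP[r r0 rP] := nbhs_within_preimage fc oO Ox Ux.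
    by exists r => // z _ /rP[Oz Uz]; rewrite extensionO.
  rewrite extension_frontier// => Ux.
  have [E [cE GE cfE GfE]] := fG_chain fx.
  have [k [kU kUq]] := Uend _ Ux _ (conj cfE GfE).
  have [l lE] := GE.1 k.
  have l0 : 0 < l.+1%:R^-1 :> R by rewrite invr_gt0.
  exists (l.+1%:R^-1) => // z cz xz.
  have [Oz|fz] := closure_cases cz.
    rewrite extensionO//; apply: kU; exists z => //; apply: (lE l) => //.
    by split=> //; rewrite ballEmdist.
  rewrite extension_frontier//; apply: kUq; first exact: prime_end_fG.
  have [E' [cE' GE' cfE' GfE']] := fG_chain fz.
  exists (fun k => f @` E' k) => //.
  (* A small enough ball about [z] fits in the ball about [x], so the image of the chain at [z]
     enters the image of [E k]. *)
  have d0 : 0 < l.+1%:R^-1 - mdist x z by rewrite subr_gt0.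
  have [m /(_ m (leqnn m)) md] := inv_nat_lt d0; have [j jE] := GE'.2 m.
  exists j; apply: image_subset => w /(jE j (leqnn j))[zw Ow].
  apply: (lE l) => //; split=> //; rewrite !ballEmdist /= in zw *.
  apply: le_lt_trans (metric_triangle x z w) _.
  by rewrite -ltrBrDl; exact: lt_trans md.
exists [set w | exists x r, [/\ 0 < r, mdist x w < r &
  forall z, closure Om z -> mdist x z < r -> U (extension z)]].
  apply/open_mdistP => w [x [r [r0 xw rP]]].
  have /open_mdistP/(_ w xw)[t t0 tP] := open_mdist_ball x r.
  by exists t => // v /tP xv; exists x, r.
apply/seteqP; split=> x [cx /= Ux]; split=> //.
  by have [r r0 rP] := loc x cx Ux; exists x, r; rewrite mdistxx.
by have [y [r [r0 yx rP]]] := Ux; exact: rP.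
Qed.

(** Sets of a chain at the prime end of [x] eventually lie in images of small balls about [x]. A
    prime end with a chain entering such a set comes from a point [z] in the closure of the small
    ball. *)
Lemma extension_open_image U V : U `<=` prime_closure D -> open V ->
  closure Om `&` extension @^-1` U = closure Om `&` V -> prime_end_open D U.
Proof.
move=> UD oV UV.
have UP z : closure Om z -> U (extension z) <-> V z.
  move=> cz; split=> Uz.
    by have : (closure Om `&` extension @^-1` U) z by []; rewrite UV => -[].
  by have : (closure Om `&` V) z by []; rewrite -UV => -[].
have UO z : Om z -> V z -> U (inl (f z)).
  by move=> Oz Vz; rewrite -extensionO//; apply/UP => //; exact: subset_closure.
split=> //.
  move=> y Uy; have Dy := UD _ Uy; have [_ _ _ _ [_ gc]] := fgP.
  have Vgy : nbhs (g y) V.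
    apply: open_nbhs_nbhs; split=> //; apply/UP.
      by apply: subset_closure; exact: gO.
    by rewrite extensionO ?fg//; exact: gO.
  apply: filterS (nbhs_within_preimage gc oD Dy Vgy) => w [Dw Vgw].
  by rewrite /= -(fg Dw); apply: UO => //; exact: gO.
move=> p Up E pE; have [x fx px] := prime_end_is_fG (UD _ Up).
have cx : closure Om x by case: fx.
have /open_mdistP/(_ x)[|r r0 rV] := oV.
  by apply/UP => //; rewrite extension_frontier// -px.
have [j /(_ j (leqnn j)) jr] := inv_nat_lt r0.
have jP z : closure (G_ Om x j) z -> mdist x z < r.
  by move=> /G_closure xz; exact: le_lt_trans jr.
have [_ GE] : end_of D (fG x) E by rewrite -px.
have [k kE] := GE.2 j; exists k; split.
  move=> _ /(kE k (leqnn k))[w [xw Ow] <-]; apply: UO => //; apply/rV/jP.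
  exact: subset_closure.
move=> q /prime_end_is_fG[z fz ->] [F [_ GF] [l lF]].
have cz : closure Om z by case: fz.
rewrite -extension_frontier//; apply/UP => //; apply/rV/jP => //.
have [m mF] := GF.1 l; apply: closureS (closure_G m cz) => w [zw Ow].
have fGw : fG z m (f w) by exists w.
have [w' Gw' ww'] := kE k (leqnn k) _ (lF _ (mF m (leqnn m) _ fGw)).
by rewrite -(gf Ow) -ww' gf//; case: Gw'.
Qed.

End Extension.

(** * Uniform continuity of [f] and its inverse from class F *)

Lemma class_F_inverse {R : realType} (X Y : metricType R) (Om : set X)
    (D : set Y) (f : X -> Y) : class_F Om D f -> exists g, inverse_homeos Om D f g.
Proof.
move=> [[[fD finj fsurj] fc [g gc gf]] _]; exists g.
have Dg y : D y -> exists2 x, Om x & f x = y by move=> /fsurj.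
by split=> // y /Dg[x Ox <-]; rewrite gf//; exact: fD.
Qed.

Section Class_F_uniform.
Context {R : realType} (X Y : metricType R).
Variables (Om : set X) (D : set Y) (f : X -> Y) (g : Y -> X).
Hypotheses (qX : quasiconvex X) (qY : quasiconvex Y).
Hypotheses (oO : open Om) (oD : open D).
Hypotheses (fF : class_F Om D f) (fgP : inverse_homeos Om D f g).

Lemma class_F_dist_M (E F : set X) : connected E -> connected F ->
  E `<` Om -> F `<` Om ->
  dist_M Om E F = 0%E <-> dist_M D (f @` E) (f @` F) = 0%E.
Proof.
move=> cE cF EO FO; have [fD _ _ _ _] := fgP.
have sub A : A `<` Om -> f @` A `<=` D by move=> [AO _] _ [x /AO/fD ? <-].
rewrite -(dist_inn_eq0_M qX oO EO.1 FO.1).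
rewrite -(dist_inn_eq0_M qY oD (sub _ EO) (sub _ FO)).
exact: fF.2.
Qed.

Lemma class_F_uniform : finely_connected D -> M_uniform Om D f.
Proof.
move=> fcD; apply: (finely_connected_uniform fgP) => // E F cE cF EO FO.
by move/(class_F_dist_M cE cF EO FO).
Qed.

(** Uses the converse implication in class F, applied to images under [g]. *)
Lemma class_F_uniform_inverse : finely_connected Om -> M_uniform D Om g.
Proof.
move=> fcO; apply: (finely_connected_uniform (inverse_homeos_sym fgP)) => //.
have [fD gO gf fg [fc gc]] := fgP.
have cg A : connected A -> A `<` D -> connected (g @` A).
  move=> cA [AD _]; apply: connected_continuous_connected => //.
  exact: continuous_subspaceW gc.
have fgK A : A `<` D -> f @` (g @` A) = A.
  move=> [AD _]; apply/seteqP; split=> [_ [_ [y Ay <-] <-]|y Ay].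
    by rewrite fg//; exact: AD.
  by exists (g y); [exists y|rewrite fg//; exact: AD].
have gsub A : A `<` D -> g @` A `<` Om.
  move=> AD; split; first by move=> _ [y /AD.1/gO ? <-].
  move=> OA; apply: AD.2 => y Dy; rewrite -(fgK A AD).
  by exists (g y); [exact/OA/gO|exact: fg].
move=> E F cE cF ED FD EF.
apply/(class_F_dist_M (cg E cE ED) (cg F cF FD) (gsub E ED) (gsub F FD)).
by rewrite !fgK.
Qed.

End Class_F_uniform.

Theorem theorem5 (R : realType) (X Y : metricType R)
  (Omega : set X) (D : set Y) (f : X -> Y)
  (X_complete : complete_space X) (X_doubling : doubling X)
  (X_quasiconvex : quasiconvex X)
  (Y_complete : complete_space Y) (Y_doubling : doubling Y)
  (Y_quasiconvex : quasiconvex Y)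
  (Omega_domain : domain Omega) (Omega_proper : Omega `<` setT)
  (Omega_bounded : metric_bounded Omega)
  (Omega_turning : bounded_turning Omega)
  (D_domain : domain D) (D_proper : D `<` setT)
  (D_bounded : metric_bounded D)
  (D_finconn : finitely_connected_at_boundary D)
  (f_F : class_F Omega D f) :
  (* [G_k^x] is the unique prime end with impression {x}, and [f(G_k^x)] is
     the end obtained by applying f to any of its chains *)
  (forall x, frontier Omega x ->
    [/\ singleton_prime_ends Omega (end_of Omega (G_ Omega x)),
        end_impression (end_of Omega (G_ Omega x)) = [set x],
        forall p, singleton_prime_ends Omega p ->
          end_impression p = [set x] -> p = end_of Omega (G_ Omega x) &
        forall E, end_of Omega (G_ Omega x) E ->
          end_of D (fun k => f @` G_ Omega x k) (fun k => f @` E k)]) /\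
  exists F_P : X -> Y + set (nat -> set Y),
    [/\ (* the formula for F_P *)
        (forall x, Omega x -> F_P x = inl (f x)) /\
        (forall x, frontier Omega x ->
           F_P x = inr (end_of D (fun k => f @` G_ Omega x k))),
        set_bij (closure Omega) (prime_closure D) F_P,
        (* F_P is a homeomorphism onto the prime end closure of D *)
        (forall U : set (Y + set (nat -> set Y)), U `<=` prime_closure D ->
           (prime_end_open D U <->
            exists2 V : set X, open V &
              closure Omega `&` F_P @^-1` U = closure Omega `&` V)),
        (* F_P is continuous with respect to dist*_M *)
        (forall x, closure Omega x -> forall e : R, 0 < e ->
           exists2 d : R, 0 < d &
             forall z, closure Omega z -> mdist x z < d ->
               (dist_M_star D (F_P x) (F_P z) < e%:E)%E) &
        (* the inverse of F_P is continuous with respect to dist*_M at every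
           point that dist*_M separates from the other points *)
        (forall x, closure Omega x ->
           (forall v, prime_closure D v ->
              dist_M_star D (F_P x) v = 0%E -> v = F_P x) ->
           forall e : R, 0 < e ->
             exists2 d : R, 0 < d &
               forall z, closure Omega z ->
                 (dist_M_star D (F_P x) (F_P z) < d%:E)%E -> mdist x z < e)].
Proof.
have [[p Op] oO _] := Omega_domain; have [_ oD _] := D_domain.
have cO := bounded_compact_closure X_complete X_doubling Omega_bounded.
have cD := bounded_compact_closure Y_complete Y_doubling D_bounded.
have [g fgP] := class_F_inverse f_F.
have uf : M_uniform Omega D f.
  apply: (class_F_uniform X_quasiconvex Y_quasiconvex oO oD f_F fgP).
  exact: finconn_finely_connected.
have ug : M_uniform D Omega g.
  apply: (class_F_uniform_inverse X_quasiconvex Y_quasiconvex oO oD f_F fgP).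
  apply: turning_finely_connected => //; exact: bounded_totally_bounded.
split.
  move=> x fx; split.
  - split; first exact: prime_end_G.
    by exists x; exact: end_impression_G.
  - exact: end_impression_G.
  - move=> p0 [pp _] px; apply: prime_end_unique => //.
    by rewrite px.
  - move=> E [cE GE]; split; first exact: (chain_image fgP).
    exact: equivalent_image.
exists (extension Omega D f); split.
- split; first exact: extensionO.
  exact: extension_frontier.
- exact: (extension_bij oO oD Omega_turning cO cD Omega_bounded
    D_bounded fgP uf ug).
- move=> U UD; split=> [oU|[V oV UV]].
    exact: (extension_open_preimage oO oD Omega_turning cO cD
      Omega_bounded D_bounded fgP uf ug oU).
  exact: (extension_open_image oO oD Omega_turning cO cD
    Omega_bounded D_bounded fgP uf ug UD oV UV).
- move=> x cx e.
  exact: (extension_continuous_M oO oD Omega_turning cD D_bounded fgP uf ug).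
- move=> x cx sep e.
  exact: (extension_inverse_continuous_M oO oD Omega_turning cO cD
    Omega_bounded D_bounded fgP uf ug cx sep).
Qed.
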